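(* Let $x(t)=\sum_{k=1}^K A_k(t)e^{i2\pi\phi_k(t)}\in\mathcal{E}_{\epsilon_1,\epsilon_3}$ for some $\epsilon_1>0,\epsilon_3>0$, and let $U_x(a,b,\lambda)$ be the adaptive time-scale-chirp_rate transform (TSC-R) of $x$ with the Gaussian window function $g(t)=\frac1{\sqrt{2\pi}}e^{-t^2/2}$. Suppose that for some $0<\Delta<1$ and $\Delta_1>0$, for any $k\neq\ell$, either $$\frac{|\phi_k'(t)-\phi_\ell'(t)|}{\phi_k'(t)+\phi_\ell'(t)}\ge\Delta \ \text{ for all } t\in\mathbb{R},\qquad\text{or}\qquad |\phi_k''(t)-\phi_\ell''(t)|\ge 2\Delta_1\ \text{ for all } t\in\mathbb{R},$$ that $2M(b)\big(\Upsilon(b)+\Pi_0(b)\big)\le\nu(b)$, and that $2\,\mathrm{Err}_\ell(b)/A_\ell(b)\le1-e^{-1/4}$ for $1\le\ell\le K$. Let $\mathcal{H}_b$ and $\mathcal{H}_{b,k}$ be the sets defined in the context with some $\widetilde\epsilon_1=\widetilde\epsilon_1(b)>0$ satisfying $$M(b)\big(\Upsilon(b)+\Pi_0(b)\big)\le\widetilde\epsilon_1\le\nu(b)-M(b)\big(\Upsilon(b)+\Pi_0(b)\big),$$ and let $(\widehat a_\ell,\widehat\lambda_\ell)=(\widehat a_\ell(b),\widehat\lambda_\ell(b))=\mathrm{argmax}_{(a,\lambda)\in\mathcal{H}_{b,\ell}}|U_x(a,b,\lambda)|$, $\ell=1,\dots,K$. Then for $\ell=1,\dots,K$, $$|\mu-\widehat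 a_\ell(b)\phi_\ell'(b)|\le\mathrm{Bd}_{1,\ell},\qquad|\widehat\lambda_\ell(b)-\phi_\ell''(b)|\le\mathrm{Bd}_{2,\ell},\qquad\big|U_x(\widehat a_\ell,b,\widehat\lambda_\ell)-x_\ell(b)\big|\le\mathrm{Bd}_{3,\ell},$$ where the quantities $\mathrm{Bd}_{1,\ell},\mathrm{Bd}_{2,\ell},\mathrm{Bd}_{3,\ell}$ (defined in the context) satisfy $$\mathrm{Bd}_{1,\ell}\le\frac{e^{1/8}}{\sigma(b)\pi}\sqrt{\frac{\mathrm{Err}_\ell(b)}{A_\ell(b)}},$$ $$\mathrm{Bd}_{2,\ell}\le\frac1{2\pi\,\sigma^2(b)\,\widehat a_\ell^{\,2}\big(1-\frac{2\mathrm{Err}_\ell(b)}{A_\ell(b)}\big)^2}\sqrt{1-\Big(1-\frac{2\mathrm{Err}_\ell(b)}{A_\ell(b)}\Big)^4},$$ $$\mathrm{Bd}_{3,\ell}\le\mathrm{Err}_\ell(b)+2e^{1/8}I_1\sqrt{\mathrm{Err}_\ell(b)A_\ell(b)}+\frac{I_2A_\ell(b)}{2\big(1-\frac{2\mathrm{Err}_\ell(b)}{A_\ell(b)}\big)^2}\sqrt{1-\Big(1-\frac{2\mathrm{Err}_\ell(b)}{A_\ell(b)}\Big)^4}.$$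
   Context: Signal class: for $\epsilon_1,\epsilon_3>0$, $\mathcal{E}_{\epsilon_1,\epsilon_3}$ is the set of signals $x(t)=\sum_{k=1}^K x_k(t)$, $x_k(t)=A_k(t)e^{i2\pi\phi_k(t)}$, with $A_k\in L_\infty(\mathbb{R})$, $A_k(t)>0$, $\phi_k\in C^3(\mathbb{R})$, $\inf_b\phi_k'(b)>0$, $\sup_b\phi_k'(b)<\infty$, $|A_k(t+\tau)-A_k(t)|\le\epsilon_1|\tau|A_k(t)$ and $|\phi_k'''(t)|\le\epsilon_3$ for all $t,\tau\in\mathbb{R}$ and $1\le k\le K$. $\mu>0$ is a constant and $\sigma(b)$ is a positive function of $b$. The adaptive TSC-R with window $g$ is $$U_x(a,b,\lambda)=\int_{\mathbb{R}}x(b+at)\frac1{\sigma(b)}g\Big(\frac t{\sigma(b)}\Big)e^{-i2\pi\mu t-i\pi\lambda a^2t^2}\,dt,$$ with $b,\lambda\in\mathbb{R}$ and scale $a$. Throughout, for each $b$ all scales $a$ lie in an interval $a_1(b)\le a\le a_2(b)$, with $0<a_1(b)\le a_2(b)<\infty$. In particular the scales occurring in the sets $Z_k$ below lie in it: for all $k$ and $b$, every $a>0$ with $|\mu-a\phi_k'(b)|<\Delta$ lies in $[a_1(b),a_2(b)]$. Polynomial Fourier transform: $\breve g(\eta,\lambda)=\int_{\mathbb{R}}g(t)e^{-i2\pi\eta t-i\pi\lambda t^2}dt$. $\nu(b)=\min_{1\le k\le K}A_k(b)$, $M(b)=\sum_{k=1}^KA_k(b)$, $I_n=\int_{\mathbb{R}}|g(t)t^n|dt$,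 $$\Pi_0(b)=\epsilon_1I_1\sigma(b)a_2(b)+\frac\pi3\epsilon_3I_3\sigma^3(b)a_2(b)^3,\qquad \Pi_\ell(b)=\epsilon_1I_1\sigma(b)\frac{\mu+\Delta}{\phi_\ell'(b)}+\frac\pi3\epsilon_3I_3\sigma^3(b)\Big(\frac{\mu+\Delta}{\phi_\ell'(b)}\Big)^3\ (1\le\ell\le K).$$ $Z_k=\{(a,b,\lambda):|\mu-a\phi_k'(b)|<\Delta\ \text{and}\ |\lambda-\phi_k''(b)|<\Delta_1,\ b\in\mathbb{R}\}$. $\Upsilon(b)$ and $\Upsilon_{\ell,k}(b)$ ($k\ne\ell$) are functions with $\Upsilon(b)\ge\Upsilon_{\ell,k}(b)$ such that, writing $G_k(a,b,\lambda)=\big|\breve g\big(\sigma(b)(\mu-a\phi_k'(b)),\ \sigma^2(b)a^2(\lambda-\phi_k''(b))\big)\big|$, $$\sup_{\{(a,\lambda):(a,b,\lambda)\notin\bigcup_{j=1}^KZ_j\}}G_k(a,b,\lambda)\le\Upsilon(b)\ (1\le k\le K),\qquad \sup_{\{(a,\lambda):(a,b,\lambda)\in Z_\ell\}}G_k(a,b,\lambda)\le\Upsilon_{\ell,k}(b)\ (k\ne\ell).$$ $\mathrm{Err}_\ell(b)=M(b)\Pi_\ell(b)+\sum_{k\ne\ell}A_k(b)\Upsilon_{\ell,k}(b)$, the sum being over $1\le k\le K$, $k\neq\ell$. $\mathcal{H}_b=\{(a,\lambda):|U_x(a,b,\lambda)|>\widetilde\epsilon_1\}$ and $\mathcal{H}_{b,k}=\{(a,\lambda)\in\mathcal{H}_b:|\mu-a\phi_k'(b)|<\Delta\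 \text{and}\ |\lambda-\phi_k''(b)|<\Delta_1\}$. The argmax denotes a point of $\mathcal{H}_{b,\ell}$ at which $|U_x(\cdot,b,\cdot)|$ attains its maximum over $\mathcal{H}_{b,\ell}$. Let $\beta(\eta)=e^{-2\pi^2\eta^2}$ and $\gamma(\lambda)=(1+4\pi^2\lambda^2)^{-1/4}$ on $[0,\infty)$, with inverses $\beta^{-1}(\xi)=\frac1{\pi\sqrt2}\sqrt{-\ln\xi}$ and $\gamma^{-1}(\xi)=\frac1{2\pi\xi^2}\sqrt{1-\xi^4}$ for $0<\xi\le1$. With $\xi_\ell=1-2\,\mathrm{Err}_\ell(b)/A_\ell(b)$, $$\mathrm{Bd}_{1,\ell}=\frac1{\sigma(b)}\beta^{-1}(\xi_\ell),\quad\mathrm{Bd}_{2,\ell}=\frac1{\sigma^2(b)\widehat a_\ell^{\,2}}\gamma^{-1}(\xi_\ell),\quad\mathrm{Bd}_{3,\ell}=\mathrm{Err}_\ell(b)+2\pi I_1A_\ell(b)\beta^{-1}(\xi_\ell)+\pi I_2A_\ell(b)\gamma^{-1}(\xi_\ell).$$ *)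

(* Defs.v *)
From HB Require Import structures.
From mathcomp Require Import all_boot all_order all_algebra complex.
From mathcomp Require Import all_classical all_reals all_analysis.
From mathcomp Require Import ring.

Set Implicit Arguments.
Unset Strict Implicit.
Unset Printing Implicit Defensive.

Import Order.TTheory GRing.Theory Num.Theory.
Import numFieldNormedType.Exports.

Local Open Scope classical_set_scope.
Local Open Scope complex_scope.
Local Open Scope ring_scope.

Section Analysis.
Context {R : realType}.
Implicit Types (f : R -> R) (F : R -> R[i]) (th : R).

Definition expi th : R[i] := cos th +i* sin th.

(* Componentwise Lebesgue integral over the whole line. *)
Definition Cintegral F : R[i] :=
  (\int[lebesgue_measure]_t complex.Re (F t)) +i*
  (\int[lebesgue_measure]_t complex.Im (F t)).

Definition cmod (z : R[i]) : R := Normc.normc z.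

Lemma cmodE (z : R[i]) : (cmod z)%:C = `|z|.
Proof. by []. Qed.

Definition C3 f : Prop :=
  (forall (n : nat) (t : R), (n < 3)%N -> derivable (derive1n n f) t 1) /\
  continuous (derive1n 3 f).

Definition gauss_window (t : R) : R :=
  (Num.sqrt (2 * pi))^-1 * expR (- (t ^+ 2 / 2)).

Definition abs_moment (g : R -> R) (n : nat) : R :=
  \int[lebesgue_measure]_t `|g t * t ^+ n|.

Definition poly_fourier (g : R -> R) (eta lam : R) : R[i] :=
  Cintegral (fun t =>
    (g t)%:C * expi (- (2 * pi * eta * t) - pi * lam * t ^+ 2)).

Definition tscr (g : R -> R) (mu : R) (sigma : R -> R) (x : R -> R[i])
    (a b lam : R) : R[i] :=
  Cintegral (fun t =>
    x (b + a * t) * ((sigma b)^-1 * g (t / sigma b))%:C *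
    expi (- (2 * pi * mu * t) - pi * lam * a ^+ 2 * t ^+ 2)).

(* [beta_inv] and [gamma_inv] are only used on ]0, 1]; the lemmas below show
   that they invert [beta_win] and [gamma_win] there, with values in
   [0, +oo[. *)
Definition beta_win (eta : R) : R := expR (- (2 * pi ^+ 2 * eta ^+ 2)).

Definition gamma_win (lam : R) : R :=
  (1 + 4 * pi ^+ 2 * lam ^+ 2) `^ (- (4^-1)).

Definition beta_inv (xi : R) : R :=
  (pi * Num.sqrt 2)^-1 * Num.sqrt (- ln xi).

Definition gamma_inv (xi : R) : R :=
  (2 * pi * xi ^+ 2)^-1 * Num.sqrt (1 - xi ^+ 4).

Lemma beta_invK (xi : R) : 0 < xi <= 1 ->
  0 <= beta_inv xi /\ beta_win (beta_inv xi) = xi.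
Proof.
move=> /andP[x0 x1]; have pi0 := @pi_gt0 R; split.
  by rewrite mulr_ge0 ?sqrtr_ge0 // invr_ge0 mulr_ge0 ?sqrtr_ge0 ?ltW.
rewrite /beta_win /beta_inv exprMn exprVn exprMn !sqr_sqrtr ?ler0n //;
  last by rewrite oppr_ge0 ln_le0.
rewrite [2 * _]mulrC mulrA divff ?mul1r ?opprK ?lnK ?posrE //.
by rewrite mulf_neq0 ?pnatr_eq0 // expf_neq0 // gt_eqF.
Qed.

Lemma gamma_invK (xi : R) : 0 < xi <= 1 ->
  0 <= gamma_inv xi /\ gamma_win (gamma_inv xi) = xi.
Proof.
move=> /andP[x0 x1]; have pi0 := @pi_gt0 R; split.
  by rewrite mulr_ge0 ?sqrtr_ge0 // invr_ge0 !mulr_ge0 ?ltW.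
rewrite /gamma_win /gamma_inv exprMn exprVn sqr_sqrtr; last first.
  by rewrite subr_ge0 exprn_ile1 // ltW.
have -> : 1 + 4 * pi ^+ 2 * (((2 * pi * xi ^+ 2) ^+ 2)^-1 * (1 - xi ^+ 4))
    = (xi ^+ 4)^-1.
  have xn0 : xi != 0 by rewrite gt_eqF.
  have pn0 : (pi : R) != 0 by rewrite gt_eqF.
  by clear pi0; move: pi pn0 => P pn0; field; rewrite xn0 pn0.
rewrite -powR_mulrn ?ltW // -powRN -powRrM mulrNN divff ?pnatr_eq0 //.
by rewrite powRr1 // ltW.
Qed.

End Analysis.

(* A signal with [K.+1] components, indexed by ['I_K.+1]: the number of
   components is at least one, so that the minimum [nu] makes sense. *)
Section Signal.
Context {R : realType} {K : nat}.
Variables (A phi : 'I_K.+1 -> R -> R).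
Implicit Types (k l : 'I_K.+1) (a b lam t : R).

Definition component k t : R[i] := (A k t)%:C * expi (2 * pi * phi k t).

Definition signal t : R[i] := \sum_(k < K.+1) component k t.

(* Membership in E_{eps1,eps3}, as a condition on the representing families
   [A] and [phi]. A positive [ereal_inf] of the derivatives says that they are
   bounded away from 0, a finite [ereal_sup] that they are bounded. *)
Definition signal_class (eps1 eps3 : R) : Prop := forall k,
  (A k \in Lfun lebesgue_measure +oo%E) /\
  (forall t, 0 < A k t) /\
  C3 (phi k) /\
  (0 < ereal_inf (range (EFin \o derive1 (phi k))))%E /\
  (ereal_sup (range (EFin \o derive1 (phi k))) < +oo)%E /\
  (forall t tau, `|A k (t + tau) - A k t| <= eps1 * `|tau| * A k t) /\
  (forall t, `|derive1n 3 (phi k) t| <= eps3).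

Definition nu b : R := \big[Num.min/A ord0 b]_(k < K.+1) A k b.

Definition Msum b : R := \sum_(k < K.+1) A k b.

(* [Pi_at g s eps1 eps3 r] is the common form of the error terms: [Pi_0] has
   [r = a_2(b)] and [Pi_l] has [r = (mu + Delta) / phi_l'(b)]. *)
Definition Pi_at (g : R -> R) (s eps1 eps3 r : R) : R :=
  eps1 * abs_moment g 1 * s * r +
  pi / 3 * eps3 * abs_moment g 3 * s ^+ 3 * r ^+ 3.

Definition Pi0 (g sigma : R -> R) (eps1 eps3 : R) (a2 : R -> R) b : R :=
  Pi_at g (sigma b) eps1 eps3 (a2 b).

Definition Pil (g sigma : R -> R) (eps1 eps3 mu Delta : R) l b : R :=
  Pi_at g (sigma b) eps1 eps3 ((mu + Delta) / derive1 (phi l) b).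

(* Triples are ordered as (a, b, lambda). *)
Definition Zset (mu Delta Delta1 : R) k : set (R * R * R) :=
  [set p | let: (a, b, lam) := p in
     `|mu - a * derive1 (phi k) b| < Delta /\
     `|lam - derive1n 2 (phi k) b| < Delta1].

Definition Gmod (g sigma : R -> R) (mu : R) k a b lam : R :=
  cmod (poly_fourier g (sigma b * (mu - a * derive1 (phi k) b))
          (sigma b ^+ 2 * a ^+ 2 * (lam - derive1n 2 (phi k) b))).

(* All scales are restricted to the interval [a1(b), a2(b)]: in the suprema
   defining the bounds [Ups], [Upslk], and in [Hset]. [scales_cover] says that
   the positive scales occurring in the sets [Zset] lie in it. *)
Definition scale (a1 a2 : R -> R) b : set R := [set a | a1 b <= a <= a2 b].

Definition scales_cover (mu Delta : R) (a1 a2 : R -> R) : Prop :=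
  forall k b a, 0 < a -> `|mu - a * derive1 (phi k) b| < Delta ->
    scale a1 a2 b a.

Definition upsilon_bounds (g sigma : R -> R) (mu Delta Delta1 : R)
    (a1 a2 Ups : R -> R) (Upslk : 'I_K.+1 -> 'I_K.+1 -> R -> R) : Prop :=
  [/\ (forall l k b, k != l -> Upslk l k b <= Ups b),
      (forall k b,
        (ereal_sup [set (Gmod g sigma mu k p.1 b p.2)%:E | p in
           [set p : R * R | scale a1 a2 b p.1 /\
              ~ (\bigcup_j Zset mu Delta Delta1 j) (p.1, b, p.2)]]
         <= (Ups b)%:E)%E) &
      (forall l k b, k != l ->
        (ereal_sup [set (Gmod g sigma mu k p.1 b p.2)%:E | p in
           [set p : R * R | scale a1 a2 b p.1 /\
              Zset mu Delta Delta1 l (p.1, b, p.2)]]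
         <= (Upslk l k b)%:E)%E)].

Definition Err (g sigma : R -> R) (eps1 eps3 mu Delta : R)
    (Upslk : 'I_K.+1 -> 'I_K.+1 -> R -> R) l b : R :=
  Msum b * Pil g sigma eps1 eps3 mu Delta l b +
  \sum_(k < K.+1 | k != l) A k b * Upslk l k b.

Definition well_separated (Delta Delta1 : R) : Prop := forall k l, k != l ->
  (forall t, Delta <= `|derive1 (phi k) t - derive1 (phi l) t| /
                      (derive1 (phi k) t + derive1 (phi l) t)) \/
  (forall t, 2 * Delta1 <= `|derive1n 2 (phi k) t - derive1n 2 (phi l) t|).

Definition Hset (g : R -> R) (mu : R) (sigma a1 a2 teps : R -> R) b :
    set (R * R) :=
  [set p | scale a1 a2 b p.1 /\
           teps b < cmod (tscr g mu sigma signal p.1 b p.2)].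

Definition Hsetk (g : R -> R) (mu Delta Delta1 : R)
    (sigma a1 a2 teps : R -> R) b k : set (R * R) :=
  Hset g mu sigma a1 a2 teps b `&`
  [set p | `|mu - p.1 * derive1 (phi k) b| < Delta /\
           `|p.2 - derive1n 2 (phi k) b| < Delta1].

End Signal.

Definition is_argmax {R : realType} {T : Type} (f : T -> R) (D : set T)
    (p : T) : Prop :=
  D p /\ forall q, D q -> f q <= f p.

Section Bounds.
Context {R : realType}.
(* [s], [a], [err], [Al] stand for sigma(b), the maximising scale, Err_l(b)
   and A_l(b). *)
Variables (g : R -> R) (s a err Al : R).

Definition xi_of : R := 1 - 2 * err / Al.

Definition Bd1 : R := s^-1 * beta_inv xi_of.

Definition Bd2 : R := (s ^+ 2 * a ^+ 2)^-1 * gamma_inv xi_of.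

Definition Bd3 : R :=
  err + 2 * pi * abs_moment g 1 * Al * beta_inv xi_of +
  pi * abs_moment g 2 * Al * gamma_inv xi_of.

End Bounds.

(* Main.v *)
Require Import Defs.
From HB Require Import structures.
From mathcomp Require Import all_boot all_order all_algebra complex.
From mathcomp Require Import all_classical all_reals all_analysis.
From mathcomp Require Import measurable_realfun lebesgue_integral_under ring lra.
Import Order.TTheory GRing.Theory Num.Theory.
Import numFieldNormedType.Exports.
Local Open Scope classical_set_scope.
Local Open Scope ring_scope.

(** Fix [b] and a component [l], and write [G] for the polynomial Fourier
    transform of the Gaussian window.

    Near [b] the amplitude of each component is almost constant and its phase is
    almost quadratic ([taylor3]), so after the change of variables
    [t = sigma u] the transform of the [k]-th component is [x_k(b)] times the
    value [G_k] of [G] at [sigma (mu - a phi_k')] and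
    [sigma^2 a^2 (lambda - phi_k'')], up to an error controlled by absolute
    moments of the window ([scaled_integrand_approx]). On the ridge of component
    [l] the scale is at most [(mu + Delta) / phi_l'] and the other components
    contribute at most [A_k Upsilon_lk], so that [U] is within [Err_l] of
    [x_l(b) G_l] there ([tscr_ridge_approx]).

    At the centre of the ridge, where [mu = a phi_l'] and [lambda = phi_l''],
    one has [G_l = 1], hence [|U| >= A_l - Err_l]. The maximiser does at least
    as well as the centre: either the centre belongs to the set over which the
    maximum is taken, or its modulus is below the threshold that the maximiser
    exceeds. At the maximiser [|U| <= A_l |G_l| + Err_l], and therefore
    [|G_l| >= xi = 1 - 2 Err_l / A_l], with [xi >= exp (-1/4)].

    The modulus of [G] is known exactly: with [v = 1 + 4 pi^2 lam^2],
    [|G(eta, lam)|^2 = v^(-1/2) exp (- 4 pi^2 eta^2 / v)]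
    ([sqr_cmod_poly_fourier_gauss]). This is obtained without contour integrals:
    along the segment from the origin to [(eta, lam)] the squared modulus solves
    a linear first-order differential equation, found by differentiating under
    the integral sign and integrating by parts. The lower bound [|G| >= xi] then
    confines [lam] because the Gaussian factor is at most 1, and confines [eta]
    because [xi >= exp (-1/4)] prevents the growth of [exp (- 4 pi^2 eta^2 / v)]
    in [v] from beating the decay of [v^(-1/2)]
    ([gauss_fourier_localization]). Finally, [G_l] is close to 1 when its
    arguments are small ([cmod_poly_fourier_sub1]), which recovers the
    component from [U]. *)

Set Implicit Arguments.
Unset Strict Implicit.
Unset Printing Implicit Defensive.

(** * Derivatives of explicit real functions *)

Section PointwiseDerivatives.
Context {R : realType}.
Implicit Types (f g : R -> R) (x a b : R).

Lemma der_add f g x a b : is_derive x 1 f a -> is_derive x 1 g b ->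
  is_derive x 1 (fun t => f t + g t) (a + b).
Proof. by move=> fa gb; exact: (is_deriveD fa gb). Qed.

Lemma der_opp f x a : is_derive x 1 f a ->
  is_derive x 1 (fun t => - f t) (- a).
Proof. by move=> fa; exact: (is_deriveN fa). Qed.

Lemma der_mul f g x a b : is_derive x 1 f a -> is_derive x 1 g b ->
  is_derive x 1 (fun t => f t * g t) (f x * b + g x * a).
Proof. by move=> fa gb; exact: (is_deriveM fa gb). Qed.

Lemma der_cst x a : is_derive x 1 (fun=> a) (0 : R).
Proof. exact: is_derive_cst. Qed.

Lemma der_id x : is_derive x 1 (fun t : R => t) (1 : R).
Proof. exact: is_derive_id. Qed.

Lemma der_scale f x a b : is_derive x 1 f a ->
  is_derive x 1 (fun t => b * f t) (b * a).
Proof.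
move=> fa; have := der_mul (der_cst x b) fa.
by rewrite mulr0 addr0.
Qed.

Lemma der_comp f g x a b : is_derive (g x) 1 f a -> is_derive x 1 g b ->
  is_derive x 1 (fun t => f (g t)) (a * b).
Proof. by move=> fa gb; exact: (is_derive1_comp fa gb). Qed.

Lemma der_expR g x b : is_derive x 1 g b ->
  is_derive x 1 (fun t => expR (g t)) (expR (g x) * b).
Proof. by move=> gb; apply: der_comp; exact: is_derive_expR. Qed.

Lemma der_cos g x b : is_derive x 1 g b ->
  is_derive x 1 (fun t => cos (g t)) (- sin (g x) * b).
Proof. by move=> gb; apply: der_comp; exact: is_derive_cos. Qed.

Lemma der_sqr x : is_derive x 1 (fun t : R => t ^+ 2) (2 * x).
Proof.
by apply: (trigger_derive (der_mul (der_id x) (der_id x))); ring.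
Qed.

Lemma der_continuous f (f' : R -> R) :
  (forall x, is_derive x 1 f (f' x)) -> continuous f.
Proof.
by move=> ff' x; apply/differentiable_continuous/derivable1_diffP; case: (ff' x).
Qed.

Lemma der_derive1 f x a : is_derive x 1 f a -> derive1 f x = a.
Proof. by move=> [_ <-]; rewrite derive1E. Qed.

Lemma derivable_der f x : derivable f x 1 -> is_derive x 1 f (derive1 f x).
Proof. by move=> df; apply: DeriveDef => //; rewrite derive1E. Qed.

End PointwiseDerivatives.
(** * Moments of the Gaussian window *)

Section GaussMoments.
Context {R : realType}.
Local Notation leb := (@lebesgue_measure R).
Local Notation g := (@gauss_window R).
Implicit Types (t : R) (n : nat).

Lemma gauss_gt0 t : 0 < g t.
Proof.
rewrite /gauss_window mulr_gt0 ?expR_gt0// invr_gt0 sqrtr_gt0.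
by rewrite mulr_gt0 ?pi_gt0.
Qed.

Lemma der_gauss t : is_derive t 1 g (- t * g t).
Proof.
have h := der_scale (Num.sqrt (2 * pi))^-1
  (der_expR (der_opp (der_mul (der_sqr t) (der_cst t 2^-1)))).
by apply: (trigger_derive h); rewrite /gauss_window; move: (Num.sqrt _)^-1 => k; field.
Qed.

Lemma gauss_continuous : continuous g.
Proof. exact: der_continuous der_gauss. Qed.

Lemma gaussE : g = normal_pdf 0 1.
Proof.
apply/funext => t; rewrite normal_pdfE ?oner_eq0//.
rewrite /gauss_window /normal_peak /normal_fun expr1n mul1r subr0.
by rewrite mulr_natl mulNr.
Qed.

Lemma integral_gauss : \int[leb]_t g t = 1.
Proof. by rewrite gaussE /Rintegral integral_normal_pdf. Qed.

(** From [1 + x <= exp x] at [x = t^2 / (4 n)], raised to the power [n]. *)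
Lemma sqrX_le_expR n t : (t ^+ 2) ^+ n <= (4 * n%:R) ^+ n * expR (t ^+ 2 / 4).
Proof.
case: n => [|n].
  by rewrite !expr0 mul1r -[leLHS]expR0 ler_expR divr_ge0 ?sqr_ge0.
have -> : expR (t ^+ 2 / 4) = expR (t ^+ 2 / (4 * n.+1%:R)) ^+ n.+1.
  rewrite -expRM_natl; congr expR.
  by field; rewrite nat1r pnatr_eq0.
rewrite -exprMn lerXn2r ?nnegrE ?sqr_ge0 ?mulr_ge0 ?expR_ge0//.
rewrite mulrC -ler_pdivrMr ?mulr_gt0 ?ltr0n//.
by apply: le_trans (expR_ge1Dx _); rewrite lerDr.
Qed.

(** The density of variance 2 is proportional to the square root of the window,
    so half of the exponential decay is left to absorb the power of [t]; this
    one domination gives both boundedness and integrability of all moments. *)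
Lemma moment_gauss_le n : exists2 c : R, 0 <= c &
  forall t, `|t ^+ n * g t| <= c * normal_pdf 0 (Num.sqrt 2) t.
Proof.
set c0 : R := 1 + (4 * n%:R) ^+ n.
have c00 : 0 <= c0 by rewrite addr_ge0 ?exprn_ge0 ?mulr_ge0.
have s2 : Num.sqrt 2 != 0 :> R by rewrite gt_eqF// sqrtr_gt0.
have pk := normal_peak_gt0 s2.
set k := (Num.sqrt (2 * pi))^-1 : R.
have k0 : 0 <= k by rewrite invr_ge0 sqrtr_ge0.
exists (k * c0 / normal_peak (Num.sqrt 2)).
  by rewrite !mulr_ge0// invr_ge0 ltW.
move=> t; rewrite normal_pdfE// /normal_fun subr0 sqr_sqrtr//.
rewrite [leRHS]mulrA divfK ?gt_eqF// normrM (ger0_norm (ltW (gauss_gt0 t))).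
rewrite /gauss_window -/k mulrCA -mulrA ler_wpM2l//.
have -> : - t ^+ 2 / (2 *+ 2) = - (t ^+ 2 / 4).
  by rewrite -[_ *+ 2]mulr_natl; field.
have -> : expR (- (t ^+ 2 / 2)) = expR (- (t ^+ 2 / 4)) * expR (- (t ^+ 2 / 4)).
  by rewrite -expRD; congr expR; field.
rewrite mulrA ler_wpM2r ?expR_ge0//.
have tn : `|t ^+ n| <= 1 + (t ^+ 2) ^+ n.
  rewrite -exprM mulnC exprM -(real_normK (num_real (t ^+ n))).
  by have := sqr_ge0 (`|t ^+ n| - 1); have := normr_ge0 (t ^+ n); nra.
apply: (@le_trans _ _ (c0 * expR (t ^+ 2 / 4) * expR (- (t ^+ 2 / 4)))).
  rewrite ler_wpM2r ?expR_ge0// (le_trans tn)// mulrDl lerD ?sqrX_le_expR//.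
  by rewrite mul1r -[leLHS]expR0 ler_expR divr_ge0 ?sqr_ge0.
by rewrite -mulrA -expRD subrr expR0 mulr1.
Qed.

Lemma moment_gauss_bounded n : exists c : R, forall t, `|t ^+ n * g t| <= c.
Proof.
have [c c0 h] := moment_gauss_le n.
exists (c * normal_peak (Num.sqrt 2)) => t; apply: le_trans (h t) _.
by rewrite ler_wpM2l// normal_pdf_ub// gt_eqF// sqrtr_gt0.
Qed.

Lemma moment_gauss_integrable n :
  leb.-integrable setT (EFin \o (fun t => `|t ^+ n * g t|)).
Proof.
have [c c0 h] := moment_gauss_le n.
have cf : continuous (fun t => `|t ^+ n * g t|).
  move=> t; apply: cvg_norm; apply: cvgM; first exact: exprn_continuous.
  exact: gauss_continuous.
apply: (@le_integrable _ _ _ leb setT _ _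
  (fun t => (c * normal_pdf 0 (Num.sqrt 2) t)%:E)) => //.
- by apply/measurable_EFinP; apply: continuous_measurable_fun; exact: cf.
- by move=> t _; rewrite lee_fin normr_id (le_trans (h t))// ler_norm.
- under eq_fun do rewrite EFinM.
  by apply: integrableZl => //; exact: integrable_normal_pdf.
Qed.

End GaussMoments.

(** * The modulus of complex numbers *)

Section ComplexModulus.
Context {R : realType}.
Implicit Types (z w : R[i]) (a b th r : R).

Lemma ReD z w : complex.Re (z + w) = complex.Re z + complex.Re w.
Proof. by case: z; case: w. Qed.

Lemma ImD z w : complex.Im (z + w) = complex.Im z + complex.Im w.
Proof. by case: z; case: w. Qed.

Lemma ReM z w : complex.Re (z * w) =
  complex.Re z * complex.Re w - complex.Im z * complex.Im w.
Proof. by case: z; case: w. Qed.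

Lemma ImM z w : complex.Im (z * w) =
  complex.Re z * complex.Im w + complex.Im z * complex.Re w.
Proof. by case: z; case: w. Qed.

Lemma cmod_ge0 z : 0 <= cmod z.
Proof. by case: z => x y; exact: sqrtr_ge0. Qed.

Lemma sqr_cmod z : cmod z ^+ 2 = complex.Re z ^+ 2 + complex.Im z ^+ 2.
Proof. by case: z => x y; rewrite /cmod /= sqr_sqrtr// addr_ge0 ?sqr_ge0. Qed.

Lemma cmodM z w : cmod (z * w) = cmod z * cmod w.
Proof. exact: Normc.normcM. Qed.

Lemma cmodD z w : cmod (z + w) <= cmod z + cmod w.
Proof. exact: le_normcD. Qed.

Lemma cmodN z : cmod (- z) = cmod z.
Proof. exact: normcN. Qed.

Lemma cmod0 : cmod (0 : R[i]) = 0.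
Proof. exact: Normc.normc0. Qed.

Lemma cmod_sum n (f : 'I_n -> R[i]) (P : pred 'I_n) :
  cmod (\sum_(i < n | P i) f i) <= \sum_(i < n | P i) cmod (f i).
Proof.
elim/big_ind2: _ => //; first by rewrite cmod0.
by move=> z a w b za wb; rewrite (le_trans (cmodD _ _))// lerD.
Qed.

Lemma cmod_le z r : 0 <= r ->
  complex.Re z ^+ 2 + complex.Im z ^+ 2 <= r ^+ 2 -> cmod z <= r.
Proof. by move=> r0; rewrite -sqr_cmod ler_sqr ?nnegrE ?cmod_ge0. Qed.

Lemma Re_le_cmod z : `|complex.Re z| <= cmod z.
Proof.
rewrite -[leRHS](ger0_norm (cmod_ge0 z)) -ler_sqr ?nnegrE// !real_normK ?num_real//.
by rewrite sqr_cmod lerDl sqr_ge0.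
Qed.

Lemma Im_le_cmod z : `|complex.Im z| <= cmod z.
Proof.
rewrite -[leRHS](ger0_norm (cmod_ge0 z)) -ler_sqr ?nnegrE// !real_normK ?num_real//.
by rewrite sqr_cmod lerDr sqr_ge0.
Qed.

Lemma cmod_real r : cmod r%:C%C = `|r|.
Proof. by rewrite /cmod /= expr0n/= addr0 sqrtr_sqr. Qed.

Lemma cmod_expi th : cmod (expi th) = 1.
Proof. by rewrite /cmod /= cos2Dsin2 sqrtr1. Qed.

Lemma expiD a b : expi (a + b) = expi a * expi b.
Proof.
by apply/eqP; rewrite eq_complex /= cosD sinD [sin a * cos b + _]addrC !eqxx.
Qed.

Lemma expi0 : expi 0 = 1 :> R[i].
Proof. by rewrite /expi cos0 sin0. Qed.

Lemma abs_sin_le th : `|sin th| <= `|th|.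
Proof.
wlog th0 : th / 0 <= th.
  move=> h; have [/h//|/ltW th0] := leP 0 th.
  by have := h (- th); rewrite sinN !normrN oppr_ge0; exact.
have [c _] : exists2 c, c \in `[0, th] & sin th - sin 0 = cos c * (th - 0).
  apply: MVT_segment => //.
  by apply: continuous_subspaceT; exact: continuous_sin.
rewrite sin0 !subr0 => ->; rewrite normrM ler_piMl//; exact: cos_max.
Qed.

(** The squared chord is [2 - 2 cos (a - b) = 4 sin^2 ((a - b) / 2)]. *)
Lemma chord_le_arc a b : cmod (expi a - expi b) <= `|a - b|.
Proof.
apply: cmod_le => //=.
have -> : (cos a - cos b) ^+ 2 + (sin a - sin b) ^+ 2 =
    (2 * sin ((a - b) / 2)) ^+ 2.
  have := cosB a b; have -> : cos (a - b) = 1 - 2 * sin ((a - b) / 2) ^+ 2.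
    rewrite [X in cos X](_ : _ = ((a - b) / 2) *+ 2); last first.
      by rewrite -mulr_natr divfK.
    rewrite cos_mulr2n; have := cos2Dsin2 ((a - b) / 2).
    by rewrite -mulr_natr; lra.
  by have := cos2Dsin2 a; have := cos2Dsin2 b; lra.
rewrite exprMn -[X in _ <= X](_ : 2 ^+ 2 * ((a - b) / 2) ^+ 2 = _); last first.
  by rewrite -exprMn mulrC divfK// real_normK ?num_real.
rewrite ler_wpM2l// -(real_normK (num_real (sin _))).
by rewrite -(real_normK (num_real (_ / _))) lerXn2r ?nnegrE// abs_sin_le.
Qed.

End ComplexModulus.

(** * Componentwise integrals of complex-valued functions *)

Section ComplexIntegral.
Context {R : realType}.
Local Notation leb := (@lebesgue_measure R).
Implicit Types (F G : R -> R[i]) (f h : R -> R) (c : R[i]).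

Definition Cintegrable F :=
  leb.-integrable setT (EFin \o (fun t => complex.Re (F t))) /\
  leb.-integrable setT (EFin \o (fun t => complex.Im (F t))).

Definition Ccontinuous F :=
  continuous (fun t => complex.Re (F t)) /\
  continuous (fun t => complex.Im (F t)).

Lemma integrable_continuous_le f h : continuous f ->
  leb.-integrable setT (EFin \o h) -> (forall t, `|f t| <= h t) ->
  leb.-integrable setT (EFin \o f).
Proof.
move=> cf ih fh; apply: (@le_integrable _ _ _ leb setT _ _ (EFin \o h)) => //.
  by apply/measurable_EFinP; apply: continuous_measurable_fun; exact: cf.
by move=> t _; rewrite lee_fin (le_trans (fh t))// ler_norm.
Qed.

Lemma integrable_add f h : leb.-integrable setT (EFin \o f) ->
  leb.-integrable setT (EFin \o h) ->
  leb.-integrable setT (EFin \o (fun t => f t + h t)).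
Proof. by move=> intf inth; exact: (integrableD _ intf inth). Qed.

Lemma integrable_sub f h : leb.-integrable setT (EFin \o f) ->
  leb.-integrable setT (EFin \o h) ->
  leb.-integrable setT (EFin \o (fun t => f t - h t)).
Proof. by move=> intf inth; exact: (integrableB _ intf inth). Qed.

Lemma integrableZ f (k : R) : leb.-integrable setT (EFin \o f) ->
  leb.-integrable setT (EFin \o (fun t => k * f t)).
Proof.
by move=> intf; rewrite (_ : _ \o _ = (fun t => k%:E * (f t)%:E)%E)//;
  exact: integrableZl.
Qed.

Lemma Cintegrable_le F h : Ccontinuous F ->
  leb.-integrable setT (EFin \o h) -> (forall t, cmod (F t) <= h t) ->
  Cintegrable F.
Proof.
move=> [cR cI] ih Fh; split.
- apply: integrable_continuous_le ih _ => // t.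
  exact: le_trans (Re_le_cmod _) (Fh t).
- apply: integrable_continuous_le ih _ => // t.
  exact: le_trans (Im_le_cmod _) (Fh t).
Qed.

Lemma CcontinuousM F G : Ccontinuous F -> Ccontinuous G ->
  Ccontinuous (fun t => F t * G t).
Proof.
move=> [cFR cFI] [cGR cGI]; split => t.
- under eq_fun do rewrite ReM.
  by apply: cvgB; apply: cvgM; [exact: cFR|exact: cGR|exact: cFI|exact: cGI].
- under eq_fun do rewrite ImM.
  by apply: cvgD; apply: cvgM; [exact: cFR|exact: cGI|exact: cFI|exact: cGR].
Qed.

Lemma CcontinuousS n (F : 'I_n -> R -> R[i]) : (forall i, Ccontinuous (F i)) ->
  Ccontinuous (fun t => \sum_(i < n) F i t).
Proof.
move=> cF; elim: (index_enum _) => [|i s [ihR ihI]].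
  by under eq_fun do rewrite big_nil; split=> t; exact: cvg_cst.
have [cR cI] := cF i; under eq_fun do rewrite big_cons; split=> t.
- under eq_fun do rewrite ReD.
  by apply: cvgD; [exact: cR|exact: ihR].
- under eq_fun do rewrite ImD.
  by apply: cvgD; [exact: cI|exact: ihI].
Qed.

Lemma Ccontinuous_real h : continuous h -> Ccontinuous (fun t => (h t)%:C%C).
Proof. by move=> ch; split => //= t; exact: cvg_cst. Qed.

Lemma Ccontinuous_expi h : continuous h -> Ccontinuous (fun t => expi (h t)).
Proof.
move=> ch; split=> t /=.
- by apply: (cvg_comp h cos); [exact: ch|exact: continuous_cos].
- by apply: (cvg_comp h sin); [exact: ch|exact: continuous_sin].
Qed.

Lemma eq_Cintegral F G : F =1 G -> Cintegral F = Cintegral G.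
Proof. by move=> FG; congr Cintegral; exact/funext. Qed.

Lemma CintegrableD F G : Cintegrable F -> Cintegrable G ->
  Cintegrable (fun t => F t + G t).
Proof.
move=> [FR FI] [GR GI]; split.
- have -> : (fun t => complex.Re (F t + G t)) =
    (fun t => complex.Re (F t) + complex.Re (G t)).
    by apply/funext => t; case: (F t); case: (G t).
  exact: integrable_add.
- have -> : (fun t => complex.Im (F t + G t)) =
    (fun t => complex.Im (F t) + complex.Im (G t)).
    by apply/funext => t; case: (F t); case: (G t).
  exact: integrable_add.
Qed.

Lemma CintegralD F G : Cintegrable F -> Cintegrable G ->
  Cintegral (fun t => F t + G t) = Cintegral F + Cintegral G.
Proof.
move=> [FR FI] [GR GI]; rewrite /Cintegral.
transitivity ((\int[leb]_t (complex.Re (F t) + complex.Re (G t))) +i*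
              (\int[leb]_t (complex.Im (F t) + complex.Im (G t))))%C.
  by congr Complex; apply: eq_Rintegral => t _; case: (F t); case: (G t).
by rewrite !RintegralD.
Qed.

Lemma CintegrableZ c F : Cintegrable F -> Cintegrable (fun t => c * F t).
Proof.
move=> [FR FI]; split.
- under eq_fun do rewrite ReM.
  by apply: integrable_sub; exact: integrableZ.
- under eq_fun do rewrite ImM.
  by apply: integrable_add; exact: integrableZ.
Qed.

Lemma CintegralZ c F : Cintegrable F ->
  Cintegral (fun t => c * F t) = c * Cintegral F.
Proof.
move=> [FR FI]; rewrite /Cintegral.
under eq_Rintegral do rewrite ReM.
under [X in (_ +i* X)%C]eq_Rintegral do rewrite ImM.
rewrite RintegralB//; [|exact: integrableZ..].
rewrite RintegralD//; [|exact: integrableZ..].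
by rewrite !RintegralZl//; case: c.
Qed.

Lemma CintegralB F G : Cintegrable F -> Cintegrable G ->
  Cintegral (fun t => F t - G t) = Cintegral F - Cintegral G.
Proof.
move=> iF iG.
rewrite -[- Cintegral G]mulN1r -CintegralZ// -CintegralD//; last exact: CintegrableZ.
by apply: eq_Cintegral => t; rewrite mulN1r.
Qed.

Lemma Cintegrable0 : Cintegrable (fun=> 0).
Proof. by split; exact: integrable0. Qed.

Lemma Cintegral0 : Cintegral (fun=> 0) = 0 :> R[i].
Proof. by rewrite /Cintegral /= Rintegral_cst// mul0r. Qed.

Lemma CintegralS n (F : 'I_n -> R -> R[i]) : (forall i, Cintegrable (F i)) ->
  Cintegral (fun t => \sum_(i < n) F i t) = \sum_(i < n) Cintegral (F i).
Proof.
move=> iF.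
suff : forall s : seq 'I_n, Cintegrable (fun t => \sum_(i <- s) F i t) /\
    Cintegral (fun t => \sum_(i <- s) F i t) = \sum_(i <- s) Cintegral (F i).
  by move=> /(_ (index_enum _))[].
elim=> [|i s [ih1 ih2]].
  under eq_fun do rewrite big_nil.
  by rewrite big_nil Cintegral0; split => //; exact: Cintegrable0.
under eq_fun do rewrite big_cons.
by rewrite big_cons CintegralD// ih2; split => //; exact: CintegrableD.
Qed.

(** With [z] the integral, [|z|^2] is the integral of [Re (conj z * F)],
    whose integrand is at most [|z| * h]. *)
Lemma cmod_Cintegral_le F h : Cintegrable F ->
  leb.-integrable setT (EFin \o h) -> (forall t, cmod (F t) <= h t) ->
  cmod (Cintegral F) <= \int[leb]_t h t.
Proof.
move=> [FR FI] ih Fh.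
set z := Cintegral F.
have h0 : 0 <= \int[leb]_t h t.
  by apply: Rintegral_ge0 => t _; exact: le_trans (cmod_ge0 _) (Fh t).
have [z0|z0] := eqVneq (cmod z) 0; first by rewrite z0.
have zp : 0 < cmod z by rewrite lt_def z0 cmod_ge0.
have [x xE] : exists x, x = complex.Re z by eexists.
have [y yE] : exists y, y = complex.Im z by eexists.
have -> : cmod z = (cmod z)^-1 * \int[leb]_t (x * complex.Re (F t) +
    y * complex.Im (F t)).
  rewrite RintegralD//; [|exact: integrableZ..].
  rewrite !RintegralZl// -[X in _ * (x * X + _)]xE -[X in _ * (_ + y * X)]yE.
  by rewrite xE yE -!expr2 -sqr_cmod expr2 mulKf.
rewrite mulrC ler_pdivrMr// -RintegralZr//.
apply: le_Rintegral => //.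
- by apply: integrable_add; exact: integrableZ.
- by under eq_fun do rewrite mulrC; exact: integrableZ.
- move=> t _; apply: (@le_trans _ _ (cmod (F t) * cmod z)); last first.
    by rewrite ler_wpM2r ?cmod_ge0.
  have -> : cmod (F t) * cmod z = cmod (conjc z * F t).
    rewrite mulrC cmodM; congr (_ * _).
    by case: (z) => a b; rewrite /cmod /= sqrrN.
  have := le_trans (ler_norm _) (Re_le_cmod (conjc z * F t)).
  by rewrite ReM xE yE; case: (z) => a b /=; rewrite mulNr opprK.
Qed.

End ComplexIntegral.

(** * Taylor's inequality of order three *)

Section Taylor.
Context {R : realType}.
Implicit Types (f : R -> R) (x b h e t : R).

Lemma der_ge0 f (f' : R -> R) x : 0 <= x -> (forall t, is_derive t 1 f (f' t)) ->
  (forall t, 0 <= t -> 0 <= f' t) -> f 0 = 0 -> 0 <= f x.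
Proof.
move=> x0 ff' f'0 f0.
have [c /[!in_itv]/= /andP[c0 _]] : exists2 c, c \in `[0, x] &
    f x - f 0 = f' c * (x - 0).
  apply: MVT_segment => //; apply: continuous_subspaceT.
  exact: der_continuous ff'.
by rewrite f0 !subr0 => ->; rewrite mulr_ge0// f'0.
Qed.

Lemma der_shift f b x a : is_derive (b + x) 1 f a ->
  is_derive x 1 (fun t => f (b + t)) a.
Proof.
move=> fa; have h := der_comp fa (der_add (der_cst x b) (der_id x)).
by apply: (trigger_derive h); rewrite add0r mulr1.
Qed.

Lemma der_reflect f x a : is_derive (- x) 1 f a ->
  is_derive x 1 (fun t => f (- t)) (- a).
Proof.
move=> fa; have h := der_comp fa (der_opp (der_id x)).
by apply: (trigger_derive h); rewrite mulrN1.
Qed.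

Section order_three.
Variables f f1 f2 f3 : R -> R.
Hypothesis d1 : forall t, is_derive t 1 f (f1 t).
Hypothesis d2 : forall t, is_derive t 1 f1 (f2 t).
Hypothesis d3 : forall t, is_derive t 1 f2 (f3 t).

(** The difference of the two sides vanishes to second order at [h = 0] and has
    third derivative [e - f3 >= 0], so it is nonnegative by three successive
    monotonicity arguments. *)
Lemma taylor3_ub b e h : (forall t, f3 t <= e) -> 0 <= h ->
  f (b + h) - f b - f1 b * h - f2 b * (h ^+ 2 / 2) <= e * (h ^+ 3 / 6).
Proof.
move=> f3e h0.
have D2 t : 0 <= t -> 0 <= e * t + f2 b - f2 (b + t).
  move=> t0; pose D x := e * x + f2 b - f2 (b + x).
  apply: (@der_ge0 D (fun x => e * 1 + 0 - f3 (b + x))) => //.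
  - move=> x; exact: (der_add (der_add (der_scale e (der_id x)) (der_cst x _))
      (der_opp (der_shift (d3 (b + x))))).
  - by move=> x _; rewrite mulr1 addr0 subr_ge0.
  - by rewrite /D mulr0 add0r addr0 subrr.
have D1 t : 0 <= t -> 0 <= e / 2 * t ^+ 2 + (f2 b * t + f1 b - f1 (b + t)).
  move=> t0; pose D x := e / 2 * x ^+ 2 + (f2 b * x + f1 b - f1 (b + x)).
  apply: (@der_ge0 D
    (fun x => e / 2 * (2 * x) + (f2 b * 1 + 0 - f2 (b + x)))) => //.
  - move=> x; exact: (der_add (der_scale (e / 2) (der_sqr x))
      (der_add (der_add (der_scale (f2 b) (der_id x)) (der_cst x _))
        (der_opp (der_shift (d2 (b + x)))))).
  - by move=> x x0; have := D2 x x0; lra.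
  - by rewrite /D addr0; ring.
pose D x := e / 6 * (x * x ^+ 2) +
  (f2 b / 2 * x ^+ 2 + (f1 b * x + f b - f (b + x))).
suff : 0 <= D h by rewrite /D; lra.
apply: (@der_ge0 D (fun x => e / 6 * (x * (2 * x) + x ^+ 2 * 1) +
  (f2 b / 2 * (2 * x) + (f1 b * 1 + 0 - f1 (b + x))))) => //.
- move=> x; exact: (der_add (der_scale (e / 6) (der_mul (der_id x) (der_sqr x)))
    (der_add (der_scale (f2 b / 2) (der_sqr x))
      (der_add (der_add (der_scale (f1 b) (der_id x)) (der_cst x _))
        (der_opp (der_shift (d1 (b + x))))))).
- by move=> x x0; have := D1 x x0; rewrite !expr2; lra.
- by rewrite /D addr0; ring.
Qed.

End order_three.

(** The one-sided bound is applied to [f] and [- f], and, for negative [h], to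
    the reflected function [t |-> f (- t)]. *)
Lemma taylor3 (f f1 f2 f3 : R -> R) b e h :
  (forall t, is_derive t 1 f (f1 t)) -> (forall t, is_derive t 1 f1 (f2 t)) ->
  (forall t, is_derive t 1 f2 (f3 t)) -> (forall t, `|f3 t| <= e) ->
  `|f (b + h) - f b - f1 b * h - f2 b * (h ^+ 2 / 2)| <= e * (`|h| ^+ 3 / 6).
Proof.
wlog h0 : f f1 f2 f3 b h / 0 <= h => [hw|] d1 d2 d3 f3e.
  have [/hw|/ltW h0] := leP 0 h; first exact.
  have := hw (fun t => f (- t)) (fun t => - f1 (- t)) (fun t => f2 (- t))
    (fun t => - f3 (- t)) (- b) (- h).
  rewrite oppr_ge0 normrN -opprD !opprK sqrrN mulNr mulrN opprK.
  apply=> //.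
  - by move=> t; exact: der_reflect.
  - by move=> t; have := der_opp (der_reflect (d2 (- t))); rewrite opprK.
  - by move=> t; exact: der_reflect.
  - by move=> t; rewrite normrN.
rewrite (ger0_norm h0) ler_norml; apply/andP; split; last first.
  by apply: (taylor3_ub d1 d2 d3) => // t; exact: le_trans (ler_norm _) (f3e t).
have := @taylor3_ub (fun t => - f t) (fun t => - f1 t) (fun t => - f2 t)
  (fun t => - f3 t) (fun t => der_opp (d1 t)) (fun t => der_opp (d2 t))
  (fun t => der_opp (d3 t)) b e h.
have f3e' t : - f3 t <= e by rewrite (le_trans _ (f3e t))// -normrN ler_norm.
by move=> /(_ f3e' h0); lra.
Qed.

End Taylor.

(** * Scaling, and integrals of derivatives over the line *)

Section LineIntegrals.
Context {R : realType}.
Local Notation leb := (@lebesgue_measure R).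
Implicit Types (f h k : R -> R) (s t : R).

(** Substitution holds for the positive and the negative part separately, and
    the integral is by definition their difference. *)
Lemma Rintegral_scale f s : 0 < s -> continuous f ->
  \int[leb]_t (s^-1 * f (t / s)) = \int[leb]_t f t.
Proof.
move=> s0 cf.
have si0 : 0 < s^-1 by rewrite invr_gt0.
pose F t : R := s^-1 * t.
have dF t : is_derive t 1 F s^-1.
  by apply: (trigger_derive (der_scale s^-1 (der_id t))); rewrite mulr1.
have F'E : derive1 F = fun=> s^-1 by apply/funext => t; exact: der_derive1.
have sub (G : R -> R) : continuous G -> (forall t, 0 <= G t) ->
    (\int[leb]_t (G t)%:E = \int[leb]_t (s^-1 * G (t / s))%:E)%E.
  move=> cG G0.
  rewrite (@increasing_ge0_integration_by_substitutionT _ F G)//.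
  - by apply: eq_integral => t _; rewrite F'E /F /= mulrC [t / s]mulrC.
  - by move=> x y xy; rewrite /F ltr_pM2l.
  - by rewrite F'E; exact: cst_continuous.
  - by rewrite F'E; exact: is_cvg_cst.
  - by rewrite F'E; exact: is_cvg_cst.
  - rewrite /F; apply: gt0_cvgMrNy => //; exact: cvg_id.
  - rewrite /F; apply: gt0_cvgMry => //; exact: cvg_id.
rewrite /Rintegral integralE [in RHS]integralE.
congr (fine (_ - _)%E).
- transitivity (\int[leb]_t (s^-1 * Num.max (f (t / s)) 0)%:E)%E.
    apply: eq_integral => t _.
    by rewrite funeposE maxr_pMr ?ltW// mulr0 EFin_max.
  rewrite -(sub (fun t => Num.max (f t) 0)).
  + by apply: eq_integral => t _; rewrite funeposE EFin_max.
  + by apply: max_fun_continuous => //; exact: cst_continuous.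
  + by move=> t; rewrite le_max lexx orbT.
- transitivity (\int[leb]_t (s^-1 * Num.max (- f (t / s)) 0)%:E)%E.
    apply: eq_integral => t _.
    by rewrite funenegE maxr_pMr ?ltW// mulr0 EFin_max mulrN.
  rewrite -(sub (fun t => Num.max (- f t) 0)).
  + by apply: eq_integral => t _; rewrite funenegE EFin_max.
  + apply: max_fun_continuous; last exact: cst_continuous.
    by move=> t; apply: cvgN; exact: cf.
  + by move=> t; rewrite le_max lexx orbT.
Qed.

Lemma Cintegral_scale (F : R -> R[i]) s : 0 < s -> Ccontinuous F ->
  Cintegral (fun t => (s^-1)%:C%C * F (t / s)) = Cintegral F.
Proof.
move=> s0 [cR cI].
rewrite /Cintegral -(Rintegral_scale s0 cR) -(Rintegral_scale s0 cI).
by congr Complex; apply: eq_Rintegral => t _;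
  rewrite ?ReM ?ImM /= mul0r ?subr0 ?addr0.
Qed.

(** The integral over [-N, N] is [h N - h (- N)], which is O(1/N); dominated
    convergence identifies the limit with the integral over the line. *)
Lemma Rintegral_der0 h k (c : R) : (forall t, is_derive t 1 h (k t)) ->
  continuous k -> leb.-integrable setT (EFin \o k) ->
  (forall t, `|t * h t| <= c) -> \int[leb]_t k t = 0.
Proof.
move=> hk ck ik hc.
pose N n : R := n.+1%:R.
pose D n := `[- N n, N n]%classic.
have N0 n : 0 < N n by rewrite ltr0n.
have ftc n : (\int[leb]_t ((k \_ (D n)) t)%:E = (h (N n) - h (- N n))%:E)%E.
  rewrite EFinB -(@continuous_FTC2 _ k h (- N n) (N n)).
  - by rewrite [RHS]integral_mkcond; apply: eq_integral => t _;
      rewrite restrict_EFin.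
  - by rewrite (@lt_trans _ _ 0) ?oppr_lt0.
  - exact: continuous_subspaceT.
  - split.
    + by move=> t _; case: (hk t).
    + by apply: cvg_at_right_filter; exact: (der_continuous hk).
    + by apply: cvg_at_left_filter; exact: (der_continuous hk).
  - by move=> t _; exact: der_derive1.
have hN t : t != 0 -> `|h t| <= c / `|t|.
  by move=> t0; rewrite ler_pdivlMr ?normr_gt0// mulrC -normrM.
have lim0 : (h (N n) - h (- N n)) @[n --> \oo] --> (0 : R).
  apply: norm_cvg0; apply: (@squeeze_cvgr _ _ _ _ (cst 0)
    (fun n => 2 * c * harmonic n)); last 2 first.
  - exact: cvg_cst.
  - by rewrite -[X in _ --> X](mulr0 (2 * c)); apply: cvgM;
      [exact: cvg_cst|exact: cvg_harmonic].
  apply: nearW => n; rewrite normr_ge0/= (le_trans (ler_normB _ _))//.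
  have := hN (N n); have := hN (- N n).
  rewrite oppr_eq0 normrN (gtr0_norm (N0 n)) gt_eqF// => /(_ isT) h1 /(_ isT) h2.
  apply: le_trans (lerD h2 h1) _.
  by rewrite le_eqVlt; apply/orP; left; apply/eqP; rewrite /harmonic /= /N; ring.
have mk : measurable_fun setT (EFin \o k).
  by apply/measurable_EFinP; exact: continuous_measurable_fun.
have mkD n : measurable_fun setT (fun t => ((k \_ (D n)) t)%:E).
  apply/measurable_EFinP; apply/(measurable_restrictT _ (measurable_itv _)).
  by apply: measurable_funTS; exact: continuous_measurable_fun.
have limk t : setT t -> ((k \_ (D n)) t)%:E @[n --> \oo] --> (k t)%:E.
  move=> _; apply: cvg_near_cst.
  near=> n; rewrite patchE mem_set// /D /= in_itv /= -ler_norml.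
  by rewrite (@le_trans _ _ n%:R) ?ler_nat//; near: n; exact: nbhs_infty_ger.
have domk t n : setT t ->
    (`|((k \_ (D n)) t)%:E| <= (abse \o (EFin \o k)) t)%E.
  move=> _; rewrite /= lee_fin patchE; case: ifP => // _.
  by rewrite normr0.
have [|||_ _ dc] := @dominated_convergence _ _ _ leb setT measurableT
  (fun n t => ((k \_ (D n)) t)%:E) (EFin \o k) (abse \o (EFin \o k)) mkD mk.
- by apply: aeW => t _; exact: limk.
- exact: integrable_abse.
- by apply: aeW => t n _; exact: domk.
have kE : (\int[leb]_t (k t)%:E = 0)%E.
  apply: (@cvg_unique _ _ _ _ _ _ dc) => //.
  rewrite /=; under eq_fun do rewrite ftc.
  by apply: cvg_EFin => //; exact: nearW.
by rewrite /Rintegral kE.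
Unshelve. all: by end_near. Qed.

End LineIntegrals.

(** * Moments of the chirped Gaussian *)

Section GaussFourier.
Context {R : realType}.
Local Notation leb := (@lebesgue_measure R).
Local Notation g := (@gauss_window R).
Implicit Types (f h k : R -> R) (c p r s t : R) (n : nat).

Section chirp.
Variables al be : R.

Let theta t : R := - (al * t) - be * t ^+ 2.

Let der_theta t : is_derive t 1 theta (- al - 2 * be * t).
Proof.
have h := der_add (der_opp (der_scale al (der_id t)))
  (der_opp (der_scale be (der_sqr t))).
by apply: (trigger_derive h); ring.
Qed.

(** Shifting the phase [p] by [- pi / 2] turns the cosine into a sine, so one
    family serves for the real and for the imaginary part. The parameter [s]
    moves the chirp [theta] along the segment joining it to 0. *)
Definition chirp_integrand n p s t : R := t ^+ n * g t * cos (p + s * theta t).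

Definition chirp_moment n p s : R := \int[leb]_t chirp_integrand n p s t.

Lemma der_chirp_integrand n p s t :
  is_derive t 1 (chirp_integrand n p s)
    (n%:R * chirp_integrand n.-1 p s t - chirp_integrand n.+1 p s t +
     (s * al * chirp_integrand n (p - pi / 2) s t +
      s * (2 * be) * chirp_integrand n.+1 (p - pi / 2) s t)).
Proof.
have hn : is_derive t 1 (fun t : R => t ^+ n) (n%:R * t ^+ n.-1).
  apply: DeriveDef; first exact: exprn_derivable.
  by rewrite exp_derive [LHS]mulr1.
have h := der_mul (der_mul hn (der_gauss t))
  (der_cos (der_add (der_cst t p) (der_scale s (der_theta t)))).
apply: (trigger_derive h).
rewrite /chirp_integrand [p - _ + _]addrAC cosBpihalf exprS.
by ring.
Qed.

Lemma chirp_integrand_continuous n p s : continuous (chirp_integrand n p s).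
Proof. exact: der_continuous (der_chirp_integrand n p s). Qed.

Lemma chirp_integrand_le n p s t :
  `|chirp_integrand n p s t| <= `|t ^+ n * g t|.
Proof. by rewrite /chirp_integrand normrM ler_piMr// cos_max. Qed.

Lemma chirp_integrand_integrable n p s :
  leb.-integrable setT (EFin \o chirp_integrand n p s).
Proof.
apply: (integrable_continuous_le (@chirp_integrand_continuous n p s)
  (moment_gauss_integrable n)) => t.
exact: chirp_integrand_le.
Qed.

(** Integration by parts: the derivative of the integrand has integral 0, and
    the window satisfies [g' = - t g]. For [n = 0] and [n = 1], with [p = 0] and
    [p = - pi / 2], these four relations express the first two moments through
    the zeroth. *)
Lemma chirp_moment_parts n p s :
  n%:R * chirp_moment n.-1 p s - chirp_moment n.+1 p s +
  (s * al * chirp_moment n (p - pi / 2) s +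
   s * (2 * be) * chirp_moment n.+1 (p - pi / 2) s) = 0.
Proof.
have int1 m q (k : R) : leb.-integrable setT
    (EFin \o (fun t => k * chirp_integrand m q s t)).
  by apply: integrableZ; exact: chirp_integrand_integrable.
rewrite /chirp_moment -!RintegralZl//; try exact: chirp_integrand_integrable.
rewrite -RintegralB//; try exact: chirp_integrand_integrable; try exact: (int1 _ _ _).
rewrite -!RintegralD//; try exact: int1; last 2 first.
- by apply: integrable_sub; [exact: (int1 _ _ _)|exact: chirp_integrand_integrable].
- by apply: integrable_add; exact: (int1 _ _ _).
have [c hc] := moment_gauss_bounded (R := R) n.+1.
apply: (@Rintegral_der0 _ (chirp_integrand n p s) _ c).
- by move=> t; exact: der_chirp_integrand.
- move=> t; apply: cvgD; first apply: cvgB.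
  + by apply: cvgM; [exact: cvg_cst|exact: chirp_integrand_continuous].
  + exact: chirp_integrand_continuous.
  + by apply: cvgD; apply: cvgM;
      [exact: cvg_cst|exact: chirp_integrand_continuous|
       exact: cvg_cst|exact: chirp_integrand_continuous].
- apply: integrable_add; last by apply: integrable_add; exact: (int1 _ _ _).
  by apply: integrable_sub; [exact: (int1 _ _ _)|exact: chirp_integrand_integrable].
- move=> t; rewrite normrM; apply: le_trans (hc t).
  by rewrite exprS -mulrA [leRHS]normrM ler_wpM2l// chirp_integrand_le.
Qed.

(** Differentiation under the integral sign, dominated by
    [|al| |t g| + |be| |t^2 g|]. *)
Lemma der_chirp_moment p s : is_derive s 1 (chirp_moment 0 p)
  (al * chirp_moment 1 (p - pi / 2) s + be * chirp_moment 2 (p - pi / 2) s).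
Proof.
pose F s t := chirp_integrand 0 p s t.
have dF t r : is_derive r 1 (fun r => F r t)
    (al * chirp_integrand 1 (p - pi / 2) r t +
     be * chirp_integrand 2 (p - pi / 2) r t).
  have h := der_scale (t ^+ 0 * g t)
    (der_cos (der_add (der_cst r p) (der_mul (der_id r) (der_cst r (theta t))))).
  apply: (trigger_derive h).
  rewrite /chirp_integrand [p - _ + _]addrAC cosBpihalf /theta.
  by ring.
pose G t := `|al| * `|t ^+ 1 * g t| + `|be| * `|t ^+ 2 * g t|.
have iG : leb.-integrable setT (EFin \o G).
  by apply: integrable_add; apply: integrableZ; exact: moment_gauss_integrable.
have int1 m q (k : R) : leb.-integrable setT
    (EFin \o (fun t => k * chirp_integrand m q s t)).
  by apply: integrableZ; exact: chirp_integrand_integrable.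
have sI : `]s - 1, s + 1[%classic s by rewrite /= in_itv /= ltrBlDr ltrDl ltr01.
have d1 r t : partial1of2 F r t = al * chirp_integrand 1 (p - pi / 2) r t +
     be * chirp_integrand 2 (p - pi / 2) r t.
  by rewrite /partial1of2; exact: der_derive1.
have Fi r : `]s - 1, s + 1[%classic r -> leb.-integrable setT (EFin \o F r).
  by move=> _; exact: chirp_integrand_integrable.
have Fd r t : `]s - 1, s + 1[%classic r -> setT t -> derivable (F ^~ t) r 1.
  by move=> _ _; case: (dF t r).
have G0 t : 0 <= G t by rewrite addr_ge0 ?mulr_ge0.
have FG r t : `]s - 1, s + 1[%classic r -> setT t -> `|partial1of2 F r t| <= G t.
  move=> _ _; rewrite d1; apply: le_trans (ler_normD _ _) _.
  by apply: lerD; rewrite [leLHS]normrM ler_wpM2l// chirp_integrand_le.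
apply: DeriveDef.
  exact: (derivable_under_integral measurableT sI Fi Fd G0 iG FG).
rewrite -derive1E.
have := differentiation_under_integral measurableT sI Fi Fd G0 iG FG.
rewrite /chirp_moment => ->.
under eq_Rintegral do rewrite d1.
by rewrite RintegralD// !RintegralZl//; exact: chirp_integrand_integrable.
Qed.

End chirp.
End GaussFourier.

(** * The modulus of the polynomial Fourier transform of the Gaussian *)

Section GaussFourierModulus.
Context {R : realType}.
Local Notation leb := (@lebesgue_measure R).
Local Notation g := (@gauss_window R).
Implicit Types (s t p : R) (n : nat).

Section path.
Variables al be : R.

Let v s : R := 1 + 4 * be ^+ 2 * s ^+ 2.

Let v_gt0 s : 0 < v s.
Proof. by rewrite ltr_wpDr// mulr_ge0 ?sqr_ge0// mulr_ge0 ?sqr_ge0. Qed.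

Local Notation C n s := (chirp_moment al be n 0 s).
Local Notation S n s := (chirp_moment al be n (0 - pi / 2) s).

Let chirp_moment_pi n s : chirp_moment al be n (0 - pi / 2 - pi / 2) s = - C n s.
Proof.
rewrite -[RHS]mulN1r /chirp_moment -RintegralZl//;
  last exact: chirp_integrand_integrable.
apply: eq_Rintegral => t _; rewrite /chirp_integrand.
rewrite !add0r; move: (s * _) => x.
have -> : - (pi / 2) - pi / 2 + x = x - pi / 2 - pi / 2 by ring.
by rewrite cosBpihalf sinBpihalf; ring.
Qed.

Let P s : R := C 0%N s ^+ 2 + S 0%N s ^+ 2.

(** The moments of order 1 and 2 in the derivative are eliminated by the
    integration-by-parts relations, which form two 2 x 2 linear systems of
    determinant [v s]. *)
Let der_P s : is_derive s 1 P
  (- (4 * s * be ^+ 2 / v s + 2 * s * al ^+ 2 / v s ^+ 2) * P s).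
Proof.
have h := der_add
  (der_mul (der_chirp_moment al be 0 s) (der_chirp_moment al be 0 s))
  (der_mul (der_chirp_moment al be (0 - pi / 2) s)
           (der_chirp_moment al be (0 - pi / 2) s)).
apply: (trigger_derive h).
have e1 := chirp_moment_parts al be 0 0 s.
have e2 := chirp_moment_parts al be 0 (0 - pi / 2) s.
have e3 := chirp_moment_parts al be 1 0 s.
have e4 := chirp_moment_parts al be 1 (0 - pi / 2) s.
rewrite /P; move: e1 e2 e3 e4; rewrite !chirp_moment_pi /=.
move: (C 0%N s) (C 1%N s) (C 2%N s) (S 0%N s) (S 1%N s) (S 2%N s).
move=> C0 C1 C2 S0 S1 S2 e1 e2 e3 e4.
have vn0 : v s != 0 by rewrite gt_eqF.
have C1E : C1 = (s * al * S0 - 2 * s ^+ 2 * al * be * C0) / v s.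
  apply: (canRL (mulfK vn0)); have := congr1 ( *%R (2 * s * be)) e2.
  by rewrite /v; lra.
have S1E : S1 = (- (s * al * C0) - 2 * s ^+ 2 * al * be * S0) / v s.
  apply: (canRL (mulfK vn0)); have := congr1 ( *%R (2 * s * be)) e1.
  by rewrite /v; lra.
have C2E : C2 = (C0 + s * al * S1 + 2 * s * be * (S0 - s * al * C1)) / v s.
  apply: (canRL (mulfK vn0)); have := congr1 ( *%R (2 * s * be)) e4.
  by rewrite /v; lra.
have S2E : S2 = (S0 - s * al * C1 - 2 * s * be * (C0 + s * al * S1)) / v s.
  apply: (canRL (mulfK vn0)); have := congr1 ( *%R (2 * s * be)) e3.
  by rewrite /v; lra.
rewrite C2E S2E S1E C1E; move: vn0; rewrite /v => vn0.
by field.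
Qed.

(** The squared modulus [P] solves the linear equation [der_P], whose
    integrating factor is the exponential of
    [ln (v s) / 2 + al^2 s^2 / v s]; the product is constant, equal to 1 at
    [s = 0]. *)
Lemma sqr_cmod_chirp_moment :
  C 0%N 1 ^+ 2 + S 0%N 1 ^+ 2 =
  expR (- (ln (1 + 4 * be ^+ 2) / 2 + al ^+ 2 / (1 + 4 * be ^+ 2))).
Proof.
have der_v s : is_derive s 1 v (8 * be ^+ 2 * s).
  have h := der_add (der_cst s 1) (der_scale (4 * be ^+ 2) (der_sqr s)).
  by apply: (trigger_derive h); ring.
have der_L s : is_derive s 1
    (fun s => 2^-1 * ln (v s) + al ^+ 2 * (s ^+ 2 * (v s)^-1))
    (4 * s * be ^+ 2 / v s + 2 * s * al ^+ 2 / v s ^+ 2).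
  have vn0 : v s != 0 by rewrite gt_eqF.
  have h := der_add
    (der_scale 2^-1 (der_comp (is_derive1_ln (v_gt0 s)) (der_v s)))
    (der_scale (al ^+ 2) (der_mul (der_sqr s) (is_deriveV vn0 (der_v s)))).
  apply: (trigger_derive h); move: vn0; rewrite /v /= => vn0.
  by rewrite /GRing.scale /=; field.
pose Q s := P s * expR (2^-1 * ln (v s) + al ^+ 2 * (s ^+ 2 * (v s)^-1)).
have dQ s : is_derive s 1 Q 0.
  have h := der_mul (der_P s) (der_expR (der_L s)).
  by apply: (trigger_derive h); ring.
have v0 : v 0 = 1 by rewrite /v expr0n /= mulr0 addr0.
have v1 : v 1 = 1 + 4 * be ^+ 2 by rewrite /v expr1n mulr1.
have P0 : P 0 = 1.
  have C0E n p : chirp_moment al be n p 0 = \int[leb]_t (cos p * (t ^+ n * g t)).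
    apply: eq_Rintegral => t _.
    by rewrite /chirp_integrand mul0r addr0 mulrC.
  rewrite /P !C0E cosBpihalf cos0 sin0.
  under eq_Rintegral do rewrite mul1r expr0 mul1r.
  under [X in _ + X ^+ 2]eq_Rintegral do rewrite mul0r.
  by rewrite integral_gauss Rintegral_cst// mul0r expr0n /= expr1n addr0.
have := is_derive_0_is_cst 1 0 dQ; rewrite /Q P0 v0 v1 ln1 expr0n /= expr1n.
rewrite !(mul0r, mulr0) addr0 expR0 mulr1 mul1r => /(canRL (mulfK _)).
rewrite gt_eqF ?expR_gt0// => /(_ isT).
by rewrite /P mul1r -expRN => ->; rewrite [_^-1 * ln _]mulrC.
Qed.

End path.

(** Equivalently, the modulus is
    [(1 + 4 pi^2 lam^2)^(-1/4) exp (- 2 pi^2 eta^2 / (1 + 4 pi^2 lam^2))]. *)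
Lemma sqr_cmod_poly_fourier_gauss (eta lam : R) :
  cmod (poly_fourier g eta lam) ^+ 2 =
  expR (- (ln (1 + 4 * (pi * lam) ^+ 2) / 2 +
    (2 * pi * eta) ^+ 2 / (1 + 4 * (pi * lam) ^+ 2))).
Proof.
rewrite -sqr_cmod_chirp_moment sqr_cmod; congr (_ ^+ 2 + _ ^+ 2) => /=.
- apply: eq_Rintegral => t _; rewrite /chirp_integrand expr0 add0r !mul1r.
  by rewrite mul0r subr0.
- apply: eq_Rintegral => t _; rewrite /chirp_integrand expr0 !mul1r.
  by rewrite mul0r addr0 addrAC add0r cosBpihalf.
Qed.

End GaussFourierModulus.

(** * Localization of the chirp parameters *)

Section GaussLocalization.
Context {R : realType}.
Local Notation leb := (@lebesgue_measure R).
Local Notation g := (@gauss_window R).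
Implicit Types (eta lam xi t : R) (n : nat).

Lemma abs_momentE n : abs_moment g n = \int[leb]_t `|t ^+ n * g t|.
Proof. by apply: eq_Rintegral => t _; rewrite mulrC. Qed.

Lemma abs_moment_ge0 n : 0 <= abs_moment g n.
Proof. by apply: Rintegral_ge0. Qed.

Lemma ln_le_sub1 t : 0 < t -> ln t <= t - 1.
Proof.
by move=> t0; have := @le_ln1Dx R (t - 1); rewrite [1 + _]addrC subrK; apply; lra.
Qed.

Lemma chirp_window_continuous eta lam : Ccontinuous (fun t =>
  (g t)%:C%C * expi (- (2 * pi * eta * t) - pi * lam * t ^+ 2)).
Proof.
apply: CcontinuousM; first exact/Ccontinuous_real/gauss_continuous.
apply: Ccontinuous_expi => t; apply: cvgB.
- apply: cvgN; apply: cvgM; [exact: cvg_cst|exact: cvg_id].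
- apply: cvgM; [exact: cvg_cst|exact: exprn_continuous].
Qed.

Lemma gauss_integrable : leb.-integrable setT (EFin \o g).
Proof. by rewrite gaussE; exact: integrable_normal_pdf. Qed.

Lemma chirp_window_integrable eta lam : Cintegrable (fun t =>
  (g t)%:C%C * expi (- (2 * pi * eta * t) - pi * lam * t ^+ 2)).
Proof.
apply: (Cintegrable_le (chirp_window_continuous eta lam) gauss_integrable) => t.
by rewrite cmodM cmod_real cmod_expi mulr1 gtr0_norm// gauss_gt0.
Qed.

Lemma Cintegral_gauss : Cintegral (fun t => (g t)%:C%C) = 1.
Proof. by rewrite /Cintegral /= integral_gauss Rintegral_cst// mul0r. Qed.

(** The window has integral 1 and the chirp stays within
    [2 pi |eta t| + pi |lam| t^2] of 1. *)
Lemma cmod_poly_fourier_sub1 eta lam :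
  cmod (poly_fourier g eta lam - 1) <=
  2 * pi * abs_moment g 1 * `|eta| + pi * abs_moment g 2 * `|lam|.
Proof.
have pi0 := pi_gt0 R.
have ig : Cintegrable (fun t => (g t)%:C%C).
  have := chirp_window_integrable 0 0; congr Cintegrable.
  by apply/funext => t; rewrite !(mulr0, mul0r) oppr0 addr0 expi0 mulr1.
rewrite -Cintegral_gauss -CintegralB//; last exact: chirp_window_integrable.
have -> : 2 * pi * abs_moment g 1 * `|eta| + pi * abs_moment g 2 * `|lam| =
    \int[leb]_t (2 * pi * `|eta| * `|t ^+ 1 * g t| +
                 pi * `|lam| * `|t ^+ 2 * g t|).
  rewrite RintegralD//; [|by apply: integrableZ; exact: moment_gauss_integrable..].
  rewrite !RintegralZl//; try exact: moment_gauss_integrable.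
  by rewrite -!abs_momentE; ring.
apply: cmod_Cintegral_le.
- apply: CintegrableD; first exact: chirp_window_integrable.
  have := CintegrableZ (-1) ig; congr Cintegrable.
  by apply/funext => t; rewrite mulN1r.
- by apply: integrable_add; apply: integrableZ; exact: moment_gauss_integrable.
- move=> t; set th := - _ - _.
  rewrite (_ : _ - _ = (g t)%:C%C * (expi th - expi 0)); last first.
    by rewrite expi0 mulrBr mulr1.
  rewrite cmodM cmod_real.
  apply: (@le_trans _ _ (`|g t| * (2 * pi * `|eta| * `|t| + pi * `|lam| * `|t| ^+ 2))).
    rewrite ler_wpM2l// (le_trans (chord_le_arc _ _))// subr0.
    rewrite (le_trans (ler_normB _ _))// normrN !expr2 !normrM.
    by rewrite (gtr0_norm pi0) (@ger0_norm _ 2)// mulrA.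
  by rewrite expr1 !expr2 !normrM; lra.
Qed.

(** With [v = 1 + 4 pi^2 lam^2] and [L = - ln xi], the modulus formula says
    [ln v / 2 + (2 pi eta)^2 / v <= 2 L]. The first summand alone bounds [lam].
    As [ln v >= 1 - v^-1], the left-hand side is at least the convex
    combination of [1/2] and [(2 pi eta)^2] with weights [1 - v^-1] and [v^-1];
    since [2 L <= 1/2], this forces [(2 pi eta)^2 <= 2 L]. *)
Lemma gauss_fourier_localization eta lam xi : expR (- (4^-1)) <= xi <= 1 ->
  xi <= cmod (poly_fourier g eta lam) ->
  `|eta| <= beta_inv xi /\ `|lam| <= gamma_inv xi.
Proof.
move=> /andP[xi_lb xi1] xi_le.
have pi0 := pi_gt0 R.
have xi0 : 0 < xi by exact: lt_le_trans (expR_gt0 _) xi_lb.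
set v := 1 + 4 * (pi * lam) ^+ 2.
have v1 : 1 <= v by rewrite lerDl mulr_ge0 ?sqr_ge0.
have v0 : 0 < v by exact: lt_le_trans v1.
set L := - ln xi.
have L4 : L <= 4^-1.
  by rewrite /L lerNl -[leLHS]expRK ler_ln ?posrE ?expR_gt0.
have L0 : 0 <= L by rewrite oppr_ge0 ln_le0.
have xiE : xi = expR (- L) by rewrite opprK lnK.
have main : ln v / 2 + (2 * pi * eta) ^+ 2 / v <= 2 * L.
  have : xi ^+ 2 <= cmod (poly_fourier g eta lam) ^+ 2.
    by rewrite ler_sqr ?nnegrE ?cmod_ge0 ?(ltW xi0).
  rewrite sqr_cmod_poly_fourier_gauss -/v {1}xiE -expRM_natl ler_expR; lra.
have lnv0 : 0 <= ln v by rewrite ln_ge0.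
have w0 : 0 <= (2 * pi * eta) ^+ 2 by exact: sqr_ge0.
split.
- have etaL : (2 * pi * eta) ^+ 2 <= 2 * L.
    have q0 : 0 < v^-1 by rewrite invr_gt0.
    have lnv : 1 - v^-1 <= ln v.
      by have := ln_le_sub1 q0; rewrite lnV ?posrE//; lra.
    rewrite -(ler_pM2r q0).
    have q1 : v^-1 <= 1 by rewrite invf_le1.
    nra.
  rewrite -ler_sqr ?nnegrE//; last first.
    by rewrite mulr_ge0 ?sqrtr_ge0// invr_ge0 mulr_ge0 ?sqrtr_ge0 ?ltW.
  rewrite real_normK ?num_real// /beta_inv exprMn exprVn exprMn !sqr_sqrtr//.
  rewrite mulrC ler_pdivlMr ?mulr_gt0 ?exprn_gt0//.
  by move: etaL; rewrite -/L; lra.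
- have lamL : v <= (xi ^+ 4)^-1.
    rewrite xiE -expRM_natl -expRN -[leLHS](lnK v0) ler_expR.
    have : 0 <= (2 * pi * eta) ^+ 2 / v by rewrite divr_ge0// ltW.
    by lra.
  rewrite -ler_sqr ?nnegrE//; last first.
    by rewrite mulr_ge0 ?sqrtr_ge0// invr_ge0 !mulr_ge0 ?ltW ?exprn_gt0.
  rewrite real_normK ?num_real// /gamma_inv exprMn exprVn sqr_sqrtr; last first.
    by rewrite subr_ge0 exprn_ile1// ltW.
  rewrite mulrC ler_pdivlMr ?exprn_gt0 ?mulr_gt0 ?exprn_gt0//.
  move: lamL; rewrite -[(_ ^+ 4)^-1]mul1r ler_pdivlMr ?exprn_gt0//.
  by rewrite /v; lra.
Qed.

(** As [ln (1 / xi) <= 1 / xi - 1 = (1 - xi) / xi] and [1 / xi <= exp (1/4)];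
    taking the square root halves the exponent. *)
Lemma beta_inv_le xi : expR (- (4^-1)) <= xi <= 1 ->
  beta_inv xi <= expR (8^-1) / pi * Num.sqrt ((1 - xi) / 2).
Proof.
move=> /andP[xi_lb xi1].
have pi0 := pi_gt0 R.
have xi0 : 0 < xi by exact: lt_le_trans (expR_gt0 _) xi_lb.
have lnxi : - ln xi <= expR (4^-1) * (1 - xi).
  rewrite -lnV ?posrE//.
  have q0 : 0 < xi^-1 by rewrite invr_gt0.
  apply: le_trans (ln_le_sub1 q0) _.
  have -> : xi^-1 - 1 = xi^-1 * (1 - xi) by rewrite mulrBr mulr1 mulVf ?gt_eqF.
  rewrite ler_wpM2r ?subr_ge0//.
  by rewrite -[leRHS]invrK lef_pV2 ?posrE ?invr_gt0 ?expR_gt0// -expRN.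
rewrite /beta_inv invfM [expR _ / pi]mulrC -!mulrA ler_pM2l ?invr_gt0//.
rewrite -sqrtrV// -sqrtrM ?invr_ge0//.
have -> : expR 8^-1 = Num.sqrt (expR (4^-1)) :> R.
  have -> : expR 4^-1 = expR 8^-1 ^+ 2 :> R.
    by rewrite -expRM_natl; congr expR; field.
  by rewrite sqrtr_sqr ger0_norm ?expR_ge0.
rewrite -sqrtrM ?expR_ge0// ler_sqrt ?mulr_ge0 ?expR_ge0 ?divr_ge0 ?subr_ge0//.
by lra.
Qed.

End GaussLocalization.

(** * Freezing amplitude and phase of one component *)

Section Component.
Context {R : realType}.
Local Notation leb := (@lebesgue_measure R).
Local Notation g := (@gauss_window R).
Implicit Types (t tau : R).
Variables (A phi phi1 phi2 phi3 : R -> R) (eps1 eps3 : R).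
Hypothesis A0 : forall t, 0 < A t.
Hypothesis Alip : forall t tau, `|A (t + tau) - A t| <= eps1 * `|tau| * A t.
Hypothesis d1 : forall t, is_derive t 1 phi (phi1 t).
Hypothesis d2 : forall t, is_derive t 1 phi1 (phi2 t).
Hypothesis d3 : forall t, is_derive t 1 phi2 (phi3 t).
Hypothesis phi3_le : forall t, `|phi3 t| <= eps3.
Hypothesis eps1_gt0 : 0 < eps1.

Lemma slow_continuous : continuous A.
Proof.
move=> t; apply/cvgrPdist_le => e e0.
have d0 : 0 < e / (eps1 * A t) by rewrite divr_gt0// mulr_gt0.
near=> y.
have := Alip t (y - t); rewrite [t + _]addrC subrK distrC => h.
apply: le_trans h _; rewrite mulrAC mulrC -ler_pdivlMr ?mulr_gt0// distrC.
Unshelve. all: by end_near. Qed.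

Let moment_normE n t : `|t ^+ n * g t| = `|t| ^+ n * g t.
Proof. by rewrite [LHS]normrM normrX (gtr0_norm (gauss_gt0 t)). Qed.

Variables (mu s a b lam : R).
Hypotheses (s0 : 0 < s) (a0 : 0 < a).

(** The integrand of one component of the transform, in the variable
    [u = t / s] that gives the window unit width. *)
Definition scaled_integrand u : R[i] :=
  (A (b + a * (s * u)))%:C%C * expi (2 * pi * phi (b + a * (s * u))) *
  (g u)%:C%C * expi (- (2 * pi * mu * (s * u)) - pi * lam * a ^+ 2 * (s * u) ^+ 2).

Let shift_continuous : continuous (fun u : R => b + a * (s * u)).
Proof.
move=> u; apply: cvgD; first exact: cvg_cst.
by apply: cvgM; [exact: cvg_cst|apply: cvgM; [exact: cvg_cst|exact: cvg_id]].
Qed.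

Lemma scaled_integrand_continuous : Ccontinuous scaled_integrand.
Proof.
have su : continuous (fun u : R => s * u).
  by move=> u; apply: cvgM; [exact: cvg_cst|exact: cvg_id].
apply: CcontinuousM; last first.
  apply: Ccontinuous_expi => u; apply: cvgB.
    by apply: cvgN; apply: cvgM; [exact: cvg_cst|exact: su].
  apply: cvgM; first exact: cvg_cst.
  by apply: (cvg_comp (fun u : R => s * u) (fun x : R => x ^+ 2));
    [exact: su|exact: exprn_continuous].
apply: CcontinuousM; last exact/Ccontinuous_real/gauss_continuous.
apply: CcontinuousM.
  apply: Ccontinuous_real => u.
  apply: (cvg_comp (fun u : R => b + a * (s * u)) A); first exact: shift_continuous.
  exact: slow_continuous.
apply: Ccontinuous_expi => u; apply: cvgM; first exact: cvg_cst.
apply: (cvg_comp (fun u : R => b + a * (s * u)) phi); first exact: shift_continuous.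
exact: (der_continuous d1).
Qed.

(** Slow variation also gives [A (b + h) <= A b (1 + eps1 |h|)], which the
    window dominates. *)
Lemma scaled_integrand_integrable : Cintegrable scaled_integrand.
Proof.
apply: (@Cintegrable_le _ _ (fun u => A b * `|u ^+ 0 * g u| +
    A b * eps1 * a * s * `|u ^+ 1 * g u|)).
- exact: scaled_integrand_continuous.
- by apply: integrable_add; apply: integrableZ; exact: moment_gauss_integrable.
- move=> u; rewrite !cmodM !cmod_real !cmod_expi !mulr1.
  rewrite !moment_normE expr0 expr1 mul1r (gtr0_norm (A0 _)).
  rewrite (gtr0_norm (gauss_gt0 u)).
  have h := ler_normlW (Alip b (a * (s * u))); move: h.
  rewrite !normrM (gtr0_norm a0) (gtr0_norm s0).
  have := gauss_gt0 u; move: (A (_ + _)) (g u) => A1 gu /ltW g0 h.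
  have {}h : A1 <= A b + A b * eps1 * a * s * `|u| by lra.
  by have := ler_wpM2r g0 h; lra.
Qed.

Let eta := s * (mu - a * phi1 b).
Let Lam := s ^+ 2 * a ^+ 2 * (lam - phi2 b).

(** Freezing the amplitude at [b] costs [eps1 |h| A b] with [h = a s u], and
    replacing the phase by its second-order Taylor polynomial costs
    [2 pi eps3 |h|^3 / 6]; what remains is the chirped window. *)
Lemma scaled_integrand_approx :
  cmod (Cintegral scaled_integrand -
    (A b)%:C%C * expi (2 * pi * phi b) * poly_fourier g eta Lam) <=
  A b * Pi_at g s eps1 eps3 a.
Proof.
have pi0 := pi_gt0 R.
have Cint := scaled_integrand_integrable.
rewrite -CintegralZ; last exact: chirp_window_integrable.
rewrite -CintegralB//; last exact/CintegrableZ/chirp_window_integrable.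
have -> : A b * Pi_at g s eps1 eps3 a =
    \int[leb]_u (A b * eps1 * s * a * `|u ^+ 1 * g u| +
      A b * (pi / 3) * eps3 * s ^+ 3 * a ^+ 3 * `|u ^+ 3 * g u|).
  rewrite RintegralD//; [|by apply: integrableZ; exact: moment_gauss_integrable..].
  rewrite !RintegralZl//; try exact: moment_gauss_integrable.
  by rewrite -!abs_momentE /Pi_at; ring.
apply: cmod_Cintegral_le.
- apply: CintegrableD => //.
  have := CintegrableZ (- ((A b)%:C%C * expi (2 * pi * phi b)))
    (chirp_window_integrable eta Lam).
  by congr Cintegrable; apply/funext => u; rewrite mulNr.
- by apply: integrable_add; apply: integrableZ; exact: moment_gauss_integrable.
- move=> u; rewrite /scaled_integrand.
  set h := a * (s * u).
  set th := - (2 * pi * mu * _) - _.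
  set ph := - _ - _.
  rewrite (_ : _ - _ = (g u)%:C%C *
     (((A (b + h) - A b)%:C%C * expi (2 * pi * phi (b + h) + th)) +
      ((A b)%:C%C * (expi (2 * pi * phi (b + h) + th) - expi (2 * pi * phi b + ph)))));
    last by rewrite !expiD rmorphB /=; ring.
  rewrite cmodM cmod_real (gtr0_norm (gauss_gt0 _)).
  have hE : `|h| = a * s * `|u|.
    by rewrite /h !normrM (gtr0_norm a0) (gtr0_norm s0) mulrA.
  have amp : cmod ((A (b + h) - A b)%:C%C * expi (2 * pi * phi (b + h) + th)) <=
      eps1 * (a * s * `|u|) * A b.
    by rewrite cmodM cmod_expi mulr1 cmod_real -hE.
  have phase : cmod ((A b)%:C%C *
      (expi (2 * pi * phi (b + h) + th) - expi (2 * pi * phi b + ph))) <=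
      A b * (2 * pi * (eps3 * ((a * s * `|u|) ^+ 3 / 6))).
    rewrite cmodM cmod_real (gtr0_norm (A0 b)) ler_wpM2l ?(ltW (A0 b))//.
    apply: le_trans (chord_le_arc _ _) _.
    have -> : 2 * pi * phi (b + h) + th - (2 * pi * phi b + ph) =
        2 * pi * (phi (b + h) - phi b - phi1 b * h - phi2 b * (h ^+ 2 / 2)).
      by rewrite /th /ph /eta /Lam /h; field.
    have tau0 : 0 <= 2 * pi :> R by rewrite mulr_ge0// ltW.
    rewrite normrM (ger0_norm tau0) ler_wpM2l//.
    by rewrite -hE; exact: (taylor3 _ _ d1 d2 d3 phi3_le).
  rewrite !moment_normE expr1.
  apply: (@le_trans _ _ (g u * (eps1 * (a * s * `|u|) * A b +
    A b * (2 * pi * (eps3 * ((a * s * `|u|) ^+ 3 / 6)))))); last first.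
    by rewrite le_eqVlt; apply/orP; left; apply/eqP; field.
  by rewrite ler_wpM2l ?(ltW (gauss_gt0 _))// (le_trans (cmodD _ _))// lerD.
Qed.

End Component.

(** * The transform of the signal on a ridge *)

Section SignalTransform.
Context {R : realType} {K : nat}.
Local Notation g := (@gauss_window R).
Variables (A phi : 'I_K.+1 -> R -> R) (eps1 eps3 : R).
Hypotheses (eps1_gt0 : 0 < eps1) (eps3_gt0 : 0 < eps3).
Hypothesis hx : signal_class A phi eps1 eps3.
Variables (mu : R) (sigma : R -> R).
Hypothesis sigma_gt0 : forall c : R, 0 < sigma c.
Implicit Types (k l : 'I_K.+1) (a b lam t tau : R).

Let A0 k t : 0 < A k t.
Proof. by have [_ [h _]] := hx k. Qed.

Let Alip k t tau : `|A k (t + tau) - A k t| <= eps1 * `|tau| * A k t.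
Proof. by have [_ [_ [_ [_ [_ [h _]]]]]] := hx k. Qed.

Let phi_der k n t : (n < 3)%N ->
  is_derive t 1 (derive1n n (phi k)) (derive1n n.+1 (phi k) t).
Proof.
move=> n3; have [_ [_ [[h _] _]]] := hx k.
by rewrite derive1nS; exact/derivable_der/h.
Qed.

Let phi1_gt0 k t : 0 < derive1 (phi k) t.
Proof.
have [_ [_ [_ [h _]]]] := hx k.
by rewrite -lte_fin; apply: lt_le_trans h _; apply: ereal_inf_lbound; exists t.
Qed.

Lemma component_approx k a b lam : 0 < a ->
  cmod (Cintegral (scaled_integrand (A k) (phi k) mu (sigma b) a b lam) -
    component A phi k b *
    poly_fourier g (sigma b * (mu - a * derive1 (phi k) b))
      (sigma b ^+ 2 * a ^+ 2 * (lam - derive1n 2 (phi k) b))) <=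
  A k b * Pi_at g (sigma b) eps1 eps3 a.
Proof.
move=> a0; have [_ [_ [_ [_ [_ [_ h3]]]]]] := hx k.
exact: (scaled_integrand_approx (A0 k) (Alip k) (fun t => @phi_der k 0 t isT)
  (fun t => @phi_der k 1 t isT) (fun t => @phi_der k 2 t isT) h3).
Qed.

Lemma tscr_signalE a b lam : 0 < a ->
  tscr g mu sigma (signal A phi) a b lam =
  \sum_(k < K.+1) Cintegral (scaled_integrand (A k) (phi k) mu (sigma b) a b lam).
Proof.
move=> a0; have d1 k t : is_derive t 1 (phi k) (derive1 (phi k) t).
  exact: (@phi_der k 0 t isT).
have cF k : Ccontinuous (scaled_integrand (A k) (phi k) mu (sigma b) a b lam).
  exact: (scaled_integrand_continuous (A0 k) (Alip k) (d1 k)).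
rewrite -CintegralS; last first.
  by move=> k; exact: (scaled_integrand_integrable (A0 k) (Alip k) (d1 k)).
rewrite -(Cintegral_scale (sigma_gt0 b)); last exact: CcontinuousS.
apply: eq_Cintegral => t; rewrite /signal !mulr_suml mulr_sumr.
apply: eq_bigr => k _; rewrite /scaled_integrand.
rewrite [sigma b * (t / _)]mulrC divfK ?gt_eqF//.
by rewrite rmorphM /component; ring.
Qed.

(** Cross terms are kept in the sum on the left, to be bounded separately. *)
Lemma tscr_approx a b lam : 0 < a ->
  cmod (tscr g mu sigma (signal A phi) a b lam -
    \sum_(k < K.+1) component A phi k b *
      poly_fourier g (sigma b * (mu - a * derive1 (phi k) b))
        (sigma b ^+ 2 * a ^+ 2 * (lam - derive1n 2 (phi k) b))) <=
  Msum A b * Pi_at g (sigma b) eps1 eps3 a.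
Proof.
move=> a0; rewrite tscr_signalE// -sumrB (le_trans (cmod_sum _ _))//.
by rewrite /Msum mulr_suml ler_sum// => k _; exact: component_approx.
Qed.

Lemma cmod_component k t : cmod (component A phi k t) = A k t.
Proof. by rewrite cmodM cmod_real cmod_expi mulr1 gtr0_norm. Qed.

Lemma Pi_at_le s r r' : 0 < s -> 0 <= r -> r <= r' ->
  Pi_at g s eps1 eps3 r <= Pi_at g s eps1 eps3 r'.
Proof.
move=> s0 r0 rr'; have pi0 := pi_gt0 R.
have I1 := abs_moment_ge0 (R := R) 1; have I3 := abs_moment_ge0 (R := R) 3.
apply: lerD; rewrite ler_wpM2l//.
- by rewrite !mulr_ge0// ltW.
- by rewrite !mulr_ge0 ?exprn_ge0 ?invr_ge0// ltW.
- by rewrite lerXn2r ?nnegrE// (le_trans r0).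
Qed.

Variables (Delta Delta1 : R) (a1 a2 Ups : R -> R).
Variable Upslk : 'I_K.+1 -> 'I_K.+1 -> R -> R.
Hypothesis hUps :
  upsilon_bounds phi g sigma mu Delta Delta1 a1 a2 Ups Upslk.

(** On the ridge of component [l] only that component survives: the scale is
    below [(mu + Delta) / phi_l'], which bounds the approximation error, and
    the windows of the other components are small. *)
Lemma tscr_ridge_approx l a b lam : 0 < a -> scale a1 a2 b a ->
  Zset phi mu Delta Delta1 l (a, b, lam) ->
  cmod (tscr g mu sigma (signal A phi) a b lam - component A phi l b *
      poly_fourier g (sigma b * (mu - a * derive1 (phi l) b))
        (sigma b ^+ 2 * a ^+ 2 * (lam - derive1n 2 (phi l) b))) <=
  Err A phi g sigma eps1 eps3 mu Delta Upslk l b.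
Proof.
move=> a0 sa Zl.
have := tscr_approx b lam a0; rewrite (bigD1 l)// opprD addrA.
set D := _ - component A phi l b * _; set S := \sum_(k < _ | _) _ => hD.
have -> : D = D - S + S by rewrite subrK.
apply: le_trans (cmodD _ _) _; apply: lerD.
  apply: le_trans hD _; rewrite ler_wpM2l//.
    by rewrite sumr_ge0// => k _; exact: ltW.
  apply: Pi_at_le => //; first exact: ltW.
  rewrite ler_pdivlMr//; case: Zl => + _.
  by rewrite ltr_norml => /andP[h _]; lra.
apply: le_trans (cmod_sum _ _) _; apply: ler_sum => k kl.
rewrite cmodM cmod_component ler_wpM2l ?(ltW (A0 _ _))//.
have [_ _ /(_ l k b kl) h] := hUps.
rewrite -lee_fin; apply: le_trans h.
by apply: ereal_sup_ubound; exists (a, lam).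
Qed.


End SignalTransform.

(** * Recovery of the components from the ridge maxima *)

Unset Implicit Arguments.
Set Strict Implicit.
Set Printing Implicit Defensive.

Theorem theorem3 (R : realType) (K : nat)
    (A phi : 'I_K.+1 -> R -> R) (eps1 eps3 : R)
    (mu Delta Delta1 : R) (sigma a1 a2 : R -> R)
    (Ups : R -> R) (Upslk : 'I_K.+1 -> 'I_K.+1 -> R -> R)
    (teps : R -> R) (ahat lhat : 'I_K.+1 -> R -> R) (b : R)
    (heps1 : 0 < eps1) (heps3 : 0 < eps3)
    (hx : signal_class A phi eps1 eps3)
    (hmu : 0 < mu) (hsigma : forall c : R, 0 < sigma c)
    (ha1 : forall c : R, 0 < a1 c) (ha12 : forall c : R, a1 c <= a2 c)
    (hscale : scales_cover phi mu Delta a1 a2)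
    (hDelta : 0 < Delta < 1) (hDelta1 : 0 < Delta1)
    (hUps : upsilon_bounds phi gauss_window sigma mu Delta Delta1
              a1 a2 Ups Upslk)
    (hsep : well_separated phi Delta Delta1) :
  let g : R -> R := gauss_window in
  let U := tscr g mu sigma (signal A phi) in
  let M := Msum A b in
  let P0 := Pi0 g sigma eps1 eps3 a2 b in
  let err := fun l => Err A phi g sigma eps1 eps3 mu Delta Upslk l b in
  let I1 := abs_moment g 1 in
  let I2 := abs_moment g 2 in
  2 * M * (Ups b + P0) <= nu A b ->
  (forall l, 2 * err l / A l b <= 1 - expR (- (4^-1))) ->
  0 < teps b ->
  M * (Ups b + P0) <= teps b <= nu A b - M * (Ups b + P0) ->
  (forall l, is_argmax (fun p : R * R => cmod (U p.1 b p.2))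
    (Hsetk A phi g mu Delta Delta1 sigma a1 a2 teps b l)
    (ahat l b, lhat l b)) ->
  forall l,
    let s := sigma b in
    let a := ahat l b in
    let lam := lhat l b in
    let Al := A l b in
    let r := 1 - 2 * err l / Al in
    [/\ `|mu - a * derive1 (phi l) b| <= Bd1 s (err l) Al,
        `|lam - derive1n 2 (phi l) b| <= Bd2 s a (err l) Al &
        cmod (U a b lam - component A phi l b) <= Bd3 g (err l) Al] /\
    [/\ Bd1 s (err l) Al
          <= expR (8^-1) / (s * pi) * Num.sqrt (err l / Al),
        Bd2 s a (err l) Al
          <= (2 * pi * s ^+ 2 * a ^+ 2 * r ^+ 2)^-1 * Num.sqrt (1 - r ^+ 4) &
        Bd3 g (err l) Al
          <= err l + 2 * expR (8^-1) * I1 * Num.sqrt (err l * Al) +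
             I2 * Al / (2 * r ^+ 2) * Num.sqrt (1 - r ^+ 4)].
Proof.
move=> g U M P0 err I1 I2 _ err_small _ _ hargmax l s a lam Al r.
have pi0 := pi_gt0 R.
have s0 : 0 < s by exact: hsigma.
have [_ [Apos [_ [phi'inf _]]]] := hx l.
have Al0 : 0 < Al by exact: Apos.
have phi'0 : 0 < derive1 (phi l) b.
  by rewrite -lte_fin; apply: lt_le_trans phi'inf _; apply: ereal_inf_lbound; exists b.
have /andP[Delta0 _] := hDelta.
have ridge := tscr_ridge_approx heps1 heps3 hx hsigma hUps.
have [[[sa teps_lt] Za] amax] := hargmax l.
have a0 : 0 < a by have /andP[a1a _] := sa; exact: lt_le_trans (ha1 b) a1a.
have approx_hat : cmod (U a b lam - component A phi l b * _) <= err l :=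
  ridge l a b lam a0 sa Za.
have err0 : 0 <= err l by exact: le_trans (cmod_ge0 _) approx_hat.
(* At the centre of the ridge both parameters vanish, so the window transform
   equals 1 there. *)
set ac := mu / derive1 (phi l) b.
have ac0 : 0 < ac by rewrite divr_gt0.
have acE : mu - ac * derive1 (phi l) b = 0 by rewrite /ac divfK ?gt_eqF// subrr.
have Zc : Zset phi mu Delta Delta1 l (ac, b, derive1n 2 (phi l) b).
  by split; rewrite ?acE ?subrr normr0.
have sc : scale a1 a2 b ac by apply: (hscale l) => //; case: Zc.
have approx_c : cmod (U ac b (derive1n 2 (phi l) b) - component A phi l b) <= err l.
  have := ridge l ac b (derive1n 2 (phi l) b) ac0 sc Zc.
  rewrite acE subrr !mulr0 (_ : poly_fourier _ 0 0 = 1) ?mulr1//.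
  rewrite -Cintegral_gauss; apply: eq_Cintegral => t.
  by rewrite !(mulr0, mul0r) oppr0 addr0 expi0 mulr1.
(* A centre that fails the threshold lies below the maximiser, which passes
   it; otherwise maximality applies. *)
have U_le : cmod (U ac b (derive1n 2 (phi l) b)) <= cmod (U a b lam).
  have [teps_c|c_teps] := ltP (teps b) (cmod (U ac b (derive1n 2 (phi l) b))).
    by apply: (amax (ac, derive1n 2 (phi l) b)); split => //; case: Zc.
  exact/ltW/(le_lt_trans c_teps).
set eta := s * (mu - a * derive1 (phi l) b) in approx_hat.
set Lam := s ^+ 2 * a ^+ 2 * (lam - derive1n 2 (phi l) b) in approx_hat.
have cmodC : cmod (component A phi l b) = Al by exact: (cmod_component hx).
have r_le : r <= cmod (poly_fourier g eta Lam).
  have low : Al - err l <= cmod (U ac b (derive1n 2 (phi l) b)).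
    rewrite lerBlDr -cmodC -[component A phi l b](subKr (U ac b (derive1n 2 (phi l) b))).
    by rewrite (le_trans (cmodD _ _))// cmodN lerD2l.
  have up : cmod (U a b lam) <= err l + Al * cmod (poly_fourier g eta Lam).
    rewrite -cmodC -cmodM.
    rewrite -[U a b lam](subrK (component A phi l b * poly_fourier g eta Lam)).
    by rewrite (le_trans (cmodD _ _))// lerD.
  rewrite /r -(ler_pM2l Al0) mulrBr mulrC mul1r.
  have -> : Al * (2 * err l / Al) = 2 * err l by field; rewrite gt_eqF.
  have := le_trans low (le_trans U_le up).
  by rewrite -lerBlDl -addrA -opprD -mulr2n mulr_natl.
have r_bnd : expR (- (4^-1)) <= r <= 1.
  rewrite /r; have := err_small l; rewrite -/Al => h.
  by rewrite lerBrDr -lerBrDl h gerBl divr_ge0 ?mulr_ge0// ltW.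
have [eta_le Lam_le] := gauss_fourier_localization r_bnd r_le.
have binv0 := beta_inv_le r_bnd.
have errA : (1 - r) / 2 = err l / Al by rewrite /r; field; rewrite gt_eqF.
rewrite errA in binv0.
have sa0 : 0 < s ^+ 2 * a ^+ 2 by rewrite mulr_gt0 ?exprn_gt0.
have r0 : 0 < r by have /andP[+ _] := r_bnd; exact: lt_le_trans (expR_gt0 _).
split; split.
- rewrite /Bd1 [leRHS]mulrC ler_pdivlMr// [leLHS]mulrC.
  by move: eta_le; rewrite /eta normrM (gtr0_norm s0).
- rewrite /Bd2 [leRHS]mulrC ler_pdivlMr// [leLHS]mulrC.
  by move: Lam_le; rewrite /Lam normrM (gtr0_norm sa0).
- rewrite -[U a b lam](subrK (component A phi l b * poly_fourier g eta Lam)) -addrA.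
  rewrite -[X in _ + (_ - X)]mulr1 -mulrBr (le_trans (cmodD _ _))// /Bd3 -addrA lerD//.
  rewrite cmodM cmodC.
  apply: le_trans (ler_wpM2l (ltW Al0) (cmod_poly_fourier_sub1 _ _)) _.
  have I10 := abs_moment_ge0 (R := R) 1; have I20 := abs_moment_ge0 (R := R) 2.
  have c1 : 0 <= 2 * pi * abs_moment g 1 * Al by rewrite !mulr_ge0// ltW.
  have c2 : 0 <= pi * abs_moment g 2 * Al by rewrite !mulr_ge0// ltW.
  rewrite mulrDr mulrA [X in _ + X]mulrA ![Al * _]mulrC.
  by apply: lerD; apply: ler_wpM2l.
- rewrite /Bd1; have -> : expR 8^-1 / (s * pi) * Num.sqrt (err l / Al) =
      s^-1 * (expR 8^-1 / pi * Num.sqrt (err l / Al)).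
    by rewrite invfM !mulrA [_ * s^-1]mulrC.
  by rewrite ler_wpM2l// invr_ge0 ltW.
- rewrite /Bd2 /gamma_inv -/r mulrA -invfM.
  rewrite (_ : s ^+ 2 * a ^+ 2 * _ = 2 * pi * s ^+ 2 * a ^+ 2 * r ^+ 2)//.
  by rewrite mulrA ![_ * (2 * pi)]mulrC !mulrA.
- rewrite /Bd3; apply: lerD.
  + rewrite lerD2l; have -> : Num.sqrt (err l * Al) = Al * Num.sqrt (err l / Al).
      have -> : err l * Al = Al ^+ 2 * (err l / Al) by field; rewrite gt_eqF.
      by rewrite sqrtrM ?sqr_ge0// sqrtr_sqr gtr0_norm.
    have I10 := abs_moment_ge0 (R := R) 1.
    have c0 : 0 <= 2 * pi * abs_moment g 1 * Al by rewrite !mulr_ge0// ltW.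
    apply: le_trans (ler_wpM2l c0 binv0) _.
    have reassoc (p u v w : R) : p != 0 ->
        2 * p * u * Al * (v / p * w) = 2 * v * u * (Al * w) by move=> ?; field.
    by rewrite reassoc ?gt_eqF.
  + have reassoc (p u v w : R) : p != 0 -> v != 0 ->
        p * u * Al * ((2 * p * v)^-1 * w) = u * Al / (2 * v) * w.
      by move=> ? ?; field; apply/andP.
    by rewrite /gamma_inv -/r reassoc ?gt_eqF ?exprn_gt0.
Qed.
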